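(* Let $n\geq 1$ be an odd integer, $\Gamma$ a group, and $r:\Gamma\to{\rm Spin}(n)$ a group morphism. Then $r$ is unacceptable if, and only if, there is an order $2$ character $\eta:\Gamma\to\{\pm1\}$ such that: (i) $S\simeq S\otimes\eta$ as $\mathbb{C}[\Gamma]$-modules, and (ii) no $\mathbb{R}[\Gamma]$-submodule of $E$ has determinant $\eta$.
   Context: ${\rm Spin}(n)$ is the compact spin group of the Euclidean space $\mathbb{R}^n$, with its natural surjection $\pi:{\rm Spin}(n)\to{\rm SO}(n)$ of kernel $\{\pm1\}$. $E=\mathbb{R}^n$ denotes the standard $n$-dimensional real representation of ${\rm Spin}(n)$ (via $\pi$), and, writing $n=2k+1$, $S$ denotes the spin representation of ${\rm Spin}(n)$, a $2^k$-dimensional complex representation. Via $r$, $E$ is viewed as an $\mathbb{R}[\Gamma]$-module and $S$ as a $\mathbb{C}[\Gamma]$-module. The determinant of an $\mathbb{R}[\Gamma]$-submodule $V\subset E$ is the character $\gamma\mapsto\det(\gamma|V)$. For a compact group $G$ and an arbitrary group $\Gamma$, a group morphism $r:\Gamma\to G$ is called unacceptable if there is a group morphism $r':\Gamma\to G$ such that $r(\gamma)$ and $r'(\gamma)$ are conjugate in $G$ for all $\gamma\in\Gamma$, but $r'$ is not $G$-conjugate to $r$. *)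

(* Defs.v *)
From HB Require Import structures.
From mathcomp Require Import all_boot all_order all_algebra.
From mathcomp Require Import reals.
From mathcomp Require Import complex zify ring.
Set Implicit Arguments.
Unset Strict Implicit.
Unset Printing Implicit Defensive.
Import Order.TTheory GRing.Theory Num.Theory.
Local Open Scope ring_scope.

Section SymmetricDifference.
Variable T : finType.
Implicit Types A B C : {set T}.

Definition symd A B : {set T} := (A :\: B) :|: (B :\: A).

Lemma in_symd A B x : (x \in symd A B) = (x \in A) (+) (x \in B).
Proof. by rewrite !inE; case: (x \in A); case: (x \in B). Qed.

Lemma symdA : associative symd.
Proof. by move=> A B C; apply/setP=> x; rewrite !in_symd addbA. Qed.

Lemma symdC : commutative symd.
Proof. by move=> A B; apply/setP=> x; rewrite !in_symd addbC. Qed.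

Lemma symd0 : right_id set0 symd.
Proof. by move=> A; apply/setP=> x; rewrite in_symd in_set0 addbF. Qed.

Lemma sym0d : left_id set0 symd.
Proof. by move=> A; rewrite symdC symd0. Qed.

Lemma symdd A : symd A A = set0.
Proof. by apply/setP=> x; rewrite in_symd in_set0 addbb. Qed.

Lemma symdK A : involutive (symd A).
Proof. by move=> B; rewrite symdA symdd sym0d. Qed.

Lemma symd_eq A B C : (symd A B == C) = (B == symd A C).
Proof. by apply/eqP/eqP=> [<-|->]; rewrite symdK. Qed.

Lemma card_symd A B : (#|symd A B| + #|A :&: B|.*2 = #|A| + #|B|)%N.
Proof.
rewrite cardsU (_ : _ :&: (B :\: A) = set0) ?cards0 ?subn0; last first.
  by apply/setP=> x; rewrite !inE; case: (x \in A); case: (x \in B).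
rewrite -(cardsID B A) -(cardsID A B) (setIC B A); lia.
Qed.

Lemma odd_card_symd A B : odd #|symd A B| = odd #|A| (+) odd #|B|.
Proof. by rewrite -oddD -card_symd oddD odd_double addbF. Qed.

End SymmetricDifference.

Lemma odd_bin2D a b :
  odd 'C(a + b, 2) = odd 'C(a, 2) (+) odd 'C(b, 2) (+) (odd a && odd b).
Proof.
elim: b => [|b IHb]; first by rewrite addn0 bin0n /= !addbF andbF addbF.
rewrite addnS !binS !oddD IHb !bin1 oddD oddS.
by case: (odd a); case: (odd b); case: (odd _); case: (odd _).
Qed.

(* The Clifford algebra of the Euclidean space R^n, with the convention
   v * v = |v|^2: it has basis (e_I), I a subset of {0, ..., n-1}, where e_I
   is the product of the e_i = e_[set i], i in I, in increasing order.
   Reordering e_I * e_J costs one sign per pair i in I, j in J with j < i. *)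
Section Clifford.
Variable n : nat.
Implicit Types I J K : {set 'I_n}.

Definition inversions I J : nat :=
  #|[set p : 'I_n * 'I_n in setX I J | (p.2 < p.1)%N]|.

Lemma odd_inversionsDl I I' J :
  odd (inversions (symd I I') J) = odd (inversions I J) (+) odd (inversions I' J).
Proof.
rewrite -odd_card_symd; congr (odd #|pred_of_set _|); apply/setP=> -[i j].
by rewrite in_symd !inE; case: (i \in I); case: (i \in I'); case: (j \in J);
  case: (_ < _)%N.
Qed.

Lemma odd_inversionsDr I J J' :
  odd (inversions I (symd J J')) = odd (inversions I J) (+) odd (inversions I J').
Proof.
rewrite -odd_card_symd; congr (odd #|pred_of_set _|); apply/setP=> -[i j].
by rewrite in_symd !inE; case: (i \in I); case: (j \in J); case: (j \in J');
  case: (_ < _)%N.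
Qed.

Lemma inversions0l J : inversions set0 J = 0%N.
Proof.
apply/eqP; rewrite cards_eq0; apply/eqP/setP=> p; by rewrite !inE.
Qed.

Lemma inversions0r I : inversions I set0 = 0%N.
Proof.
by apply/eqP; rewrite cards_eq0; apply/eqP/setP=> p; rewrite !inE andbF.
Qed.

Lemma inversionsC I J :
  (inversions I J + inversions J I + #|I :&: J| = #|I| * #|J|)%N.
Proof.
rewrite -cardsX.
set X := [set p in setX I J | (p.2 < p.1)%N].
set Y := [set p in setX I J | (p.1 < p.2)%N].
have -> : inversions J I = #|Y|.
  have swapK : involutive (fun p : 'I_n * 'I_n => (p.2, p.1)) by case.
  rewrite /inversions -(card_imset _ (inv_inj swapK)).
  congr #|pred_of_set _|; apply/setP=> -[i j]; rewrite !inE /=.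
  apply/imsetP/idP => [[[k l]]|H]; first by rewrite !inE /= => H [-> ->];
    rewrite [(_ \in I) && _]andbC.
  by exists (j, i) => //; rewrite !inE /= [(_ \in J) && _]andbC.
have -> : #|I :&: J| = #|[set p in setX I J | p.1 == p.2]|.
  rewrite -(card_imset _ (_ : injective (fun i : 'I_n => (i, i)))); last first.
    by move=> i j [].
  congr #|pred_of_set _|; apply/setP=> -[i j]; rewrite !inE /=.
  apply/imsetP/andP => [[k]|[/andP[iI jJ] /eqP E]].
    by rewrite inE => kIJ [-> ->].
  by subst j; exists i; rewrite ?inE ?iI.
rewrite -(cardsID [set p : 'I_n * 'I_n | (p.2 < p.1)%N] (setX I J)) -addnA; congr (_ + _)%N.
  by apply: eq_card => p; rewrite !inE.
rewrite -(cardsID [set p : 'I_n * 'I_n | (p.1 < p.2)%N]); congr (_ + _)%N;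
  apply: eq_card => -[i j]; rewrite !inE /= -?val_eqE /=;
  by case: ltngtP; rewrite ?andbT ?andbF.
Qed.

Definition clifford (R : comNzRingType) := {ffun {set 'I_n} -> R}.

Section Algebra.
Variable R : comNzRingType.
Local Notation Cl := (clifford R).
Implicit Types x y z : Cl.

HB.instance Definition _ := GRing.Lmodule.copy Cl {ffun {set 'I_n} -> R^o}.

Definition cl_sign I J : R := (-1) ^+ inversions I J.

Lemma cl_sign0l J : cl_sign set0 J = 1.
Proof. by rewrite /cl_sign inversions0l. Qed.

Lemma cl_sign0r I : cl_sign I set0 = 1.
Proof. by rewrite /cl_sign inversions0r. Qed.

Lemma cl_signDl I I' J :
  cl_sign (symd I I') J = cl_sign I J * cl_sign I' J.
Proof.
by rewrite /cl_sign -exprD -signr_odd odd_inversionsDl -oddD signr_odd.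
Qed.

Lemma cl_signDr I J J' :
  cl_sign I (symd J J') = cl_sign I J * cl_sign I J'.
Proof.
by rewrite /cl_sign -exprD -signr_odd odd_inversionsDr -oddD signr_odd.
Qed.

Definition cl_basis I : Cl := [ffun J => (J == I)%:R].

(* The bilinear extension of e_I * e_J = cl_sign I J *: e_(symd I J). *)
Definition cl_mul x y : Cl :=
  [ffun K => \sum_I \sum_(J | symd I J == K) cl_sign I J * (x I * y J)].

Lemma cl_mulE x y K :
  cl_mul x y K = \sum_I cl_sign I (symd I K) * (x I * y (symd I K)).
Proof.
rewrite ffunE; apply: eq_bigr => I _.
by rewrite (eq_bigl (pred1 (symd I K))) ?big_pred1_eq // => J; rewrite /= symd_eq.
Qed.

Lemma cl_mulA : associative cl_mul.
Proof.
move=> x y z; apply/ffunP=> K; rewrite !cl_mulE.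
under eq_bigr => I _ do
  (rewrite cl_mulE (reindex_inj (can_inj (symdK I))) /= !mulr_sumr).
under [RHS]eq_bigr => J _ do rewrite cl_mulE mulr_suml mulr_sumr.
rewrite [RHS]exchange_big /=; apply: eq_bigr => I _; apply: eq_bigr => J _.
have E : symd (symd I J) (symd I K) = symd J K.
  by rewrite (symdC I J) -symdA symdK.
rewrite E.
have -> : cl_sign (symd I J) (symd J K) =
          cl_sign I (symd J K) * cl_sign J (symd J K) by rewrite cl_signDl.
have -> : cl_sign I (symd I K) = cl_sign I (symd I J) * cl_sign I (symd J K).
  by rewrite -cl_signDr -symdA symdK.
have S2 : cl_sign I (symd J K) * cl_sign I (symd J K) = 1.
  by rewrite -cl_signDr symdd cl_sign0r.
transitivity (cl_sign I (symd J K) * cl_sign I (symd J K) *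
  (cl_sign J (symd J K) *
    (cl_sign I (symd I J) * (x I * y (symd I J)) * z (symd J K)))); first by ring.
by rewrite S2 mul1r.
Qed.

Lemma cl_mul1x : left_id (cl_basis set0) cl_mul.
Proof.
move=> x; apply/ffunP=> K; rewrite cl_mulE (bigD1 set0) //= big1 ?addr0.
  by rewrite ffunE eqxx cl_sign0l sym0d !mul1r.
by move=> I /negPf I0; rewrite ffunE I0 mul0r mulr0.
Qed.

Lemma cl_mulx1 : right_id (cl_basis set0) cl_mul.
Proof.
move=> x; apply/ffunP=> K; rewrite cl_mulE (bigD1 K) //= big1 ?addr0.
  by rewrite ffunE symdd eqxx cl_sign0r mulr1 mul1r.
move=> I IK; rewrite ffunE symd_eq symd0 eq_sym (negPf IK); by rewrite !mulr0.
Qed.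

Lemma cl_mulDl : left_distributive cl_mul +%R.
Proof.
move=> x y z; apply/ffunP=> K; rewrite [RHS]ffunE !cl_mulE -big_split /=.
by apply: eq_bigr => I _; rewrite ffunE mulrDl mulrDr.
Qed.

Lemma cl_mulDr : right_distributive cl_mul +%R.
Proof.
move=> x y z; apply/ffunP=> K; rewrite [RHS]ffunE !cl_mulE -big_split /=.
by apply: eq_bigr => I _; rewrite ffunE !mulrDr.
Qed.

Lemma cl_1neq0 : cl_basis set0 != 0.
Proof.
by apply/eqP=> /ffunP/(_ set0)/eqP; rewrite !ffunE eqxx oner_eq0.
Qed.

HB.instance Definition _ := GRing.Zmodule_isNzRing.Build Cl
  cl_mulA cl_mul1x cl_mulx1 cl_mulDl cl_mulDr cl_1neq0.

Lemma cl_scaleE (a : R) x K : (a *: x) K = a * x K.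
Proof. by rewrite ffunE. Qed.

Lemma cl_scaleAl (a : R) x y : a *: (x * y) = (a *: x) * y.
Proof.
apply/ffunP=> K; rewrite cl_scaleE !cl_mulE mulr_sumr.
by apply: eq_bigr => I _; rewrite cl_scaleE; ring.
Qed.

HB.instance Definition _ := GRing.Lmodule_isLalgebra.Build R Cl cl_scaleAl.

Lemma cl_scaleAr (a : R) x y : a *: (x * y) = x * (a *: y).
Proof.
apply/ffunP=> K; rewrite cl_scaleE !cl_mulE mulr_sumr.
by apply: eq_bigr => I _; rewrite cl_scaleE; ring.
Qed.

HB.instance Definition _ := GRing.Lalgebra_isAlgebra.Build R Cl cl_scaleAr.

End Algebra.
End Clifford.

Section Vectors.
Variables (n : nat) (R : comNzRingType).
Local Notation Cl := (clifford n R).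
Implicit Types (x y : Cl) (v w : 'rV[R]_n) (I J : {set 'I_n}).

Lemma cl_mul_coef x y K :
  (x * y) K = \sum_I cl_sign R I (symd I K) * (x I * y (symd I K)).
Proof. exact: cl_mulE. Qed.

Lemma cl_basisE I J : cl_basis R I J = (J == I)%:R.
Proof. by rewrite ffunE. Qed.

Lemma cl_basis0 : cl_basis R set0 = 1 :> Cl.
Proof. by []. Qed.

Lemma cl_addE x y K : (x + y) K = x K + y K.
Proof. by rewrite ffunE. Qed.

Lemma cl_sumE (A : Type) (s : seq A) (P : pred A) (F : A -> Cl) K :
  (\sum_(a <- s | P a) F a) K = \sum_(a <- s | P a) F a K.
Proof. by elim/big_rec2: _ => [|a y x _ <-]; rewrite ?ffunE. Qed.

Lemma cl_expand x : x = \sum_I x I *: cl_basis R I.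
Proof.
apply/ffunP=> K; rewrite cl_sumE (bigD1 K) //= big1 ?addr0.
  by rewrite cl_scaleE cl_basisE eqxx mulr1.
by move=> I IK; rewrite cl_scaleE cl_basisE eq_sym (negPf IK) mulr0.
Qed.

Lemma cl_basisM I J :
  cl_basis R I * cl_basis R J = cl_sign R I J *: cl_basis R (symd I J).
Proof.
apply/ffunP=> K; rewrite cl_mul_coef cl_scaleE cl_basisE (bigD1 I) //= big1.
  have -> : (K == symd I J) = (symd I K == J) by rewrite eq_sym symd_eq eq_sym.
  rewrite !cl_basisE eqxx mul1r addr0.
  by case: eqP => [->|]; rewrite ?mulr0.
by move=> L LI; rewrite !cl_basisE (negPf LI) mul0r mulr0.
Qed.

(* The anti-automorphism of the Clifford algebra which is the identity on R^n:
   on the product e_I of #|I| orthogonal vectors it is the sign of the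
   order-reversing permutation. *)
Definition cl_rev x : Cl := [ffun I : {set 'I_n} => (-1) ^+ 'C(#|I|, 2) * x I].

Lemma cl_revE x I : cl_rev x I = (-1) ^+ 'C(#|I|, 2) * x I.
Proof. by rewrite ffunE. Qed.

Lemma cl_revK : involutive cl_rev.
Proof. by move=> x; apply/ffunP=> I; rewrite !cl_revE signrMK. Qed.

Lemma cl_rev1 : cl_rev 1 = 1.
Proof.
apply/ffunP=> I; rewrite cl_revE cl_basisE.
by case: eqP => [->|]; rewrite ?mulr0 // cards0 mul1r.
Qed.

Lemma cl_sign_rev I J :
  (-1) ^+ 'C(#|symd I J|, 2) * cl_sign R I J =
  (-1) ^+ 'C(#|I|, 2) * (-1) ^+ 'C(#|J|, 2) * cl_sign R J I.
Proof.
rewrite /cl_sign -!exprD -signr_odd -[RHS]signr_odd; congr (_ ^+ nat_of_bool _).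
have := odd_bin2D #|symd I J| #|I :&: J|.*2; rewrite card_symd odd_bin2D.
rewrite odd_double andbF addbF.
have -> : odd 'C(#|I :&: J|.*2, 2) = odd #|I :&: J|.
  by rewrite -addnn odd_bin2D addbb andbb.
have /(congr1 odd) := inversionsC I J; rewrite !oddD oddM.
move: (odd _) (odd (inversions J I)) (odd #|_ :&: _|) (odd #|I|) (odd #|J|).
move: (odd 'C(#|symd I J|, 2)) (odd 'C(#|I|, 2)) (odd 'C(#|J|, 2)).
by do 8 case.
Qed.

Lemma cl_revM x y : cl_rev (x * y) = cl_rev y * cl_rev x.
Proof.
apply/ffunP=> K; rewrite cl_revE !cl_mul_coef mulr_sumr.
have symdIK : involutive (fun I : {set 'I_n} => symd I K).
  by move=> I; rewrite -symdA symdd symd0.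
rewrite [RHS](reindex_inj (inv_inj symdIK)); apply: eq_bigr => I _ /=.
rewrite symdIK !cl_revE.
have := cl_sign_rev I (symd I K); rewrite symdK => E.
transitivity ((-1) ^+ 'C(#|K|, 2) * cl_sign R I (symd I K) * (x I * y (symd I K))).
  exact: mulrA.
by rewrite E; ring.
Qed.

Definition cl_vec v : Cl := \sum_i v 0 i *: cl_basis R [set i].

Definition is_cl_vec x := [forall I : {set 'I_n}, (x I != 0) ==> (#|I| == 1%N)].

Lemma cl_vec_set1 v i : cl_vec v [set i] = v 0 i.
Proof.
rewrite cl_sumE (bigD1 i) //= big1 ?addr0.
  by rewrite cl_scaleE cl_basisE eqxx mulr1.
by move=> j ji; rewrite cl_scaleE cl_basisE (inj_eq set1_inj) eq_sym (negPf ji) mulr0.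
Qed.

Lemma cl_vec_delta i : cl_vec (delta_mx 0 i) = cl_basis R [set i].
Proof.
rewrite /cl_vec (bigD1 i) //= big1 ?addr0; first by rewrite mxE !eqxx scale1r.
by move=> j ji; rewrite mxE (negPf ji) andbF scale0r.
Qed.

Lemma is_cl_vecE x : is_cl_vec x -> x = cl_vec (\row_i x [set i]).
Proof.
move=> /forallP xV; apply/ffunP=> I; have /implyP := xV I.
have [/cards1P[i ->] _|I1 x0] := boolP (#|I| == 1%N).
  by rewrite cl_vec_set1 mxE.
rewrite cl_sumE big1 => [|i _]; last first.
  rewrite cl_scaleE cl_basisE; case: eqP => [E|]; last by rewrite mulr0.
  by rewrite E cards1 in I1.
by apply/eqP; apply: contraT => /x0.
Qed.

Lemma cl_vec_is_vec v : is_cl_vec (cl_vec v).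
Proof.
apply/forallP=> I; apply/implyP; apply: contraNT => I1.
rewrite cl_sumE big1 // => i _; rewrite cl_scaleE cl_basisE.
by case: eqP => [E|]; rewrite ?mulr0 //; rewrite E cards1 in I1.
Qed.

Lemma is_cl_vecP x : reflect (exists v, x = cl_vec v) (is_cl_vec x).
Proof.
apply: (iffP idP) => [/is_cl_vecE->|[v ->]]; last exact: cl_vec_is_vec.
by eexists.
Qed.

Lemma cl_vec_inj : injective cl_vec.
Proof. by move=> v w E; apply/rowP=> i; rewrite -!cl_vec_set1 E. Qed.

Lemma cl_vec_is_linear : linear cl_vec.
Proof.
move=> a v w; rewrite /cl_vec scaler_sumr -big_split; apply: eq_bigr => i _.
by rewrite !mxE scalerDl scalerA.
Qed.

HB.instance Definition _ :=
  GRing.isLinear.Build R 'rV[R]_n Cl _ cl_vec cl_vec_is_linear.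

Lemma inversions1 (i j : 'I_n) : inversions [set i] [set j] = (j < i)%N.
Proof.
rewrite /inversions; have [ji|ji] := boolP (j < i)%N.
  apply/eqP/cards1P; exists (i, j); apply/setP=> -[k l].
  by rewrite !inE xpair_eqE /=; case: eqP => //= ->; case: eqP => //= ->.
apply/eqP; rewrite cards_eq0; apply/eqP/setP=> -[k l]; rewrite !inE /=.
by case: eqP => //= ->; case: eqP => //= ->; rewrite (negPf ji).
Qed.

Lemma cl_basis1M i j : cl_basis R [set i] * cl_basis R [set j] +
  cl_basis R [set j] * cl_basis R [set i] = (i == j)%:R *+ 2 :> Cl.
Proof.
rewrite !cl_basisM (symdC [set j]) -scalerDl /cl_sign !inversions1.
have [->|ij] := eqVneq i j.
  by rewrite symdd ltnn expr0 cl_basis0 -mulr2n scaler_nat.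
move: ij; rewrite -val_eqE /=; case: ltngtP => // _ _;
  by rewrite ?subrr ?addNr ?addrN scale0r mul0rn.
Qed.

Lemma cl_vecM v w :
  cl_vec v * cl_vec w + cl_vec w * cl_vec v = ((v *m w^T) 0 0 *+ 2)%:A.
Proof.
rewrite {2 4}/cl_vec [X in X + _]mulr_sumr [X in _ + X]mulr_suml -big_split /=.
have -> : (v *m w^T) 0 0 = \sum_i v 0 i * w 0 i.
  by rewrite mxE; apply: eq_bigr => i _; rewrite mxE.
rewrite -mulr_natl mulr_sumr scaler_suml; apply: eq_bigr => i _.
rewrite -scalerAr -scalerAl -scalerDr /cl_vec mulr_suml mulr_sumr -big_split /=.
rewrite (bigD1 i) //= big1 => [|j ji]; rewrite -scalerAl -scalerAr -scalerDr
  cl_basis1M.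
  rewrite eqxx addr0 scalerA -[_%:R *+ 2]scaler_nat scalerA.
  by congr (_ *: _); ring.
by rewrite (negPf ji) mul0rn scaler0.
Qed.

Definition cl_even x := [forall I : {set 'I_n}, (x I != 0) ==> ~~ odd #|I|].

Lemma cl_even1 : cl_even 1.
Proof.
apply/forallP=> I; rewrite cl_basisE; apply/implyP.
by case: (I =P set0) => [->|]; rewrite ?cards0 ?implybT ?eqxx.
Qed.

Lemma cl_evenM x y : cl_even x -> cl_even y -> cl_even (x * y).
Proof.
move=> /forallP xE /forallP yE; apply/forallP=> K; apply/implyP.
apply: contraNN => oK; rewrite cl_mul_coef big1 // => I _.
have [oI|eI] := boolP (odd #|I|).
  have /implyP := xE I; rewrite oI; case: eqP => [->|_ /(_ isT)//].
  by rewrite mul0r mulr0.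
have /implyP := yE (symd I K); rewrite odd_card_symd oK (negPf eI) /=.
by case: eqP => [->|_ /(_ isT)//]; rewrite !mulr0.
Qed.

Lemma cl_even_rev x : cl_even x -> cl_even (cl_rev x).
Proof.
move=> /forallP xE; apply/forallP=> I; apply/implyP=> xI; apply: (implyP (xE I)).
by apply: contraNN xI => /eqP x0; rewrite cl_revE x0 mulr0.
Qed.

End Vectors.

(* Spin(n) is the group of even elements x whose inverse is their reversal
   and such that x * v * x^-1 is in R^n for all v in R^n. *)
Section Spin.
Variables (n : nat) (R : realType).
Local Notation Cl := (clifford n R).
Implicit Types (x y : Cl) (v w : 'rV[R]_n).

Definition is_spin x :=
  [&& cl_even x, x * cl_rev x == 1, cl_rev x * x == 1 &
      [forall i, is_cl_vec (x * cl_basis R [set i] * cl_rev x)]].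

(* Column i holds the coordinates of x * e_i * x^-1. *)
Definition spin_mx x : 'M[R]_n :=
  \matrix_(i, j) (x * cl_basis R [set j] * cl_rev x) [set i].

Lemma spin_mxE x v : is_spin x ->
  x * cl_vec v * cl_rev x = cl_vec (v *m (spin_mx x)^T).
Proof.
move=> /and4P[_ _ _ /forallP xV].
rewrite {1}/cl_vec mulr_sumr mulr_suml mulmx_sum_row linear_sum.
apply: eq_bigr => i _ /=; rewrite linearZ /= -scalerAr -scalerAl; congr (_ *: _).
by rewrite (is_cl_vecE (xV i)); congr cl_vec; apply/rowP=> j; rewrite !mxE.
Qed.

Lemma is_spinP x : reflect
  [/\ cl_even x, x * cl_rev x = 1, cl_rev x * x = 1 &
      forall v, exists w, x * cl_vec v * cl_rev x = cl_vec w]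
  (is_spin x).
Proof.
apply: (iffP idP) => [xS|[xE /eqP x1 /eqP x1' xV]].
  have /and4P[-> /eqP-> /eqP-> _] := xS; split=> // v.
  by rewrite spin_mxE //; eexists.
apply/and4P; split=> //; apply/forallP=> i; apply/is_cl_vecP.
by have [w E] := xV (delta_mx 0 i); exists w; rewrite -E cl_vec_delta.
Qed.

Lemma spin_mx_orthogonal x : is_spin x -> (spin_mx x)^T *m spin_mx x = 1%:M.
Proof.
move=> xS; have /is_spinP[_ xx x'x _] := xS.
apply/matrixP=> i j; set A := (spin_mx x)^T.
have /= := cl_vecM (delta_mx 0 i *m A) (delta_mx 0 j *m A).
rewrite -!spin_mxE // !mulrA -[_ * cl_rev x * x](mulrA _ (cl_rev x)).
rewrite -[X in _ + X * _]mulrA.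
have E u v : x * cl_vec u * cl_rev x * x * cl_vec v * cl_rev x
  = x * (cl_vec u * cl_vec v) * cl_rev x.
  by rewrite -[_ * cl_rev x * x]mulrA x'x mulr1 !mulrA.
rewrite !mulrA !E -mulrDl -mulrDr cl_vecM -scalerAr mulr1 -scalerAl xx.
move=> /ffunP/(_ set0); rewrite !cl_scaleE cl_basisE eqxx !mulr1.
move/eqP; rewrite eqrMn2r //= => /eqP.
rewrite trmx_mul !mulmxA => E2.
have Eij (B : 'M[R]_n) : B i j =
    ((delta_mx 0 i : 'rV_n) *m B *m (delta_mx 0 j : 'rV_n)^T) 0 0.
  by rewrite trmx_delta -rowE -colE !mxE.
rewrite !Eij mulmx1 -[spin_mx x]trmxK -/A E2.
by rewrite !mulmxA.
Qed.

Lemma spin_mx_orthogonalC x : is_spin x -> spin_mx x *m (spin_mx x)^T = 1%:M.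
Proof. by move/spin_mx_orthogonal/mulmx1C. Qed.

Lemma is_spin1 : is_spin 1.
Proof.
apply/is_spinP; rewrite cl_rev1 mulr1; split=> // [|v].
  exact: cl_even1.
by exists v; rewrite mul1r mulr1.
Qed.

Lemma is_spinM x y : is_spin x -> is_spin y -> is_spin (x * y).
Proof.
move=> xS yS; have /is_spinP[xE x1 x1' _] := xS.
have /is_spinP[yE y1 y1' _] := yS.
apply/is_spinP; rewrite cl_revM; split; first exact: cl_evenM.
- by rewrite mulrA -[x * y * _]mulrA y1 mulr1.
- by rewrite mulrA -[_ * cl_rev x * x]mulrA x1' mulr1.
move=> v; exists (v *m (spin_mx y)^T *m (spin_mx x)^T).
by rewrite -spin_mxE // -spin_mxE // !mulrA.
Qed.

Lemma is_spin_rev x : is_spin x -> is_spin (cl_rev x).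
Proof.
move=> xS; have /is_spinP[xE x1 x1' _] := xS.
apply/is_spinP; rewrite cl_revK; split=> //; first exact: cl_even_rev.
move=> v; exists (v *m spin_mx x).
have -> : cl_vec v = x * cl_vec (v *m spin_mx x) * cl_rev x.
  by rewrite spin_mxE // -mulmxA spin_mx_orthogonalC ?mulmx1.
by rewrite -!mulrA x1' mulr1 mulrA x1' mul1r.
Qed.

Lemma spin_mx1 : spin_mx 1 = 1%:M.
Proof.
apply/matrixP=> i j; rewrite !mxE cl_rev1 mul1r mulr1 cl_basisE.
by rewrite (inj_eq set1_inj).
Qed.

Lemma spin_mxM x y : is_spin x -> is_spin y ->
  spin_mx (x * y) = spin_mx x *m spin_mx y.
Proof.
move=> xS yS; apply: trmx_inj; rewrite trmx_mul.
apply/row_matrixP=> i; rewrite !rowE mulmxA; apply: cl_vec_inj.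
by rewrite -!spin_mxE ?is_spinM // cl_revM !mulrA.
Qed.

Record spin := Spin { spin_val :> Cl; spin_valP : is_spin spin_val }.

HB.instance Definition _ := [isSub for spin_val].
HB.instance Definition _ := [Choice of spin by <:].

Definition spin_one := Spin is_spin1.
Definition spin_mul (g h : spin) :=
  Spin (is_spinM (spin_valP g) (spin_valP h)).
Definition spin_inv (g : spin) := Spin (is_spin_rev (spin_valP g)).

Lemma spin_mulA : associative spin_mul.
Proof. by move=> g h k; apply: val_inj; rewrite /= mulrA. Qed.
Lemma spin_mul1g : left_id spin_one spin_mul.
Proof. by move=> g; apply: val_inj; rewrite /= mul1r. Qed.
Lemma spin_mulg1 : right_id spin_one spin_mul.
Proof. by move=> g; apply: val_inj; rewrite /= mulr1. Qed.
Lemma spin_mulVg : left_inverse spin_one spin_inv spin_mul.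
Proof. by move=> g; apply: val_inj; case/is_spinP: (spin_valP g). Qed.
Lemma spin_mulgV : right_inverse spin_one spin_inv spin_mul.
Proof. by move=> g; apply: val_inj; case/is_spinP: (spin_valP g). Qed.

HB.instance Definition _ := isGroup.Build spin
  spin_mulA spin_mul1g spin_mulg1 spin_mulVg spin_mulgV.

End Spin.

(* Any family g_i of pairwise anticommuting square roots of 1 in a ring defines
   a representation of the Clifford algebra. *)
Section CliffordWords.
Variables (n : nat) (A : pzRingType) (g : 'I_n -> A).
Implicit Types (I J : {set 'I_n}) (s : seq 'I_n).
Hypothesis g2 : forall i, g i * g i = 1.
Hypothesis gC : forall i j, i != j -> g i * g j = - (g j * g i).

Definition cl_word I : A := \prod_(i | i \in I) g i.

Let word s I : A := \prod_(i <- s | i \in I) g i.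
Let lt_ord : rel 'I_n := fun i j => (i < j)%N.

Let lt_ord_trans : transitive lt_ord.
Proof. by move=> i j k; apply: ltn_trans. Qed.

Let sorted_enum : sorted lt_ord (enum 'I_n).
Proof. by have := iota_ltn_sorted 0 n; rewrite -val_enum_ord sorted_map. Qed.

Let word_out s I j : j \notin s -> word s (symd I [set j]) = word s I.
Proof.
move=> js; rewrite /word big_seq_cond [RHS]big_seq_cond; apply: eq_bigl => i.
rewrite in_symd inE; case: eqP => [->|]; last by rewrite addbF.
by rewrite (negPf js).
Qed.

Let word_mulC s I j : j \notin s ->
  word s I * g j = (-1) ^+ count (mem I) s * (g j * word s I).
Proof.
elim: s => [|a s IHs] js; first by rewrite /word !big_nil !mul1r mulr1.
move: js; rewrite inE negb_or => /andP[ja /IHs E].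
rewrite /word !big_cons /=; case: ifP => aI; last by rewrite -E.
rewrite -mulrA [X in g a * X]E add1n exprS mulN1r [g a * (_ * _)]mulrA commr_sign.
rewrite -[_ * g a * _]mulrA.
by rewrite [g a * (_ * _)]mulrA gC 1?eq_sym // !mulNr mulrN -[_ * g a * _]mulrA.
Qed.

Let word_mul1 s I j : sorted lt_ord s -> j \in s ->
  word s I * g j =
  (-1) ^+ count (fun i => (i \in I) && (j < i)%N) s * word s (symd I [set j]).
Proof.
elim: s => [|a s IHs] //= ps; have as_ := order_path_min lt_ord_trans ps.
have anots : a \notin s.
  by apply/negP=> /(allP as_); rewrite /lt_ord ltnn.
rewrite inE; have [->{j IHs} _|ja /= js] := eqVneq j a.
  rewrite /word !big_cons in_symd inE eqxx addbT ltnn andbF add0n.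
  have -> : count (fun i => (i \in I) && (a < i)%N) s = count (mem I) s.
    by apply: eq_in_count => i /(allP as_); rewrite /lt_ord /= => ->; rewrite andbT.
  have := word_mulC I anots; have := word_out I anots.
  rewrite /word => -> E; case: ifP => _ /=; last by rewrite E.
  by rewrite -mulrA E mulrA commr_sign -mulrA [g a * _]mulrA g2 mul1r.
have aj : (a < j)%N by apply: (allP as_).
rewrite ltnNge (ltnW aj) andbF add0n /word !big_cons in_symd inE (eq_sym a).
rewrite (negPf ja) addbF; have := IHs (path_sorted ps) js; rewrite /word => E.
by case: ifP => _ //; rewrite -mulrA E mulrA commr_sign mulrA.
Qed.

Let wordE I : cl_word I = word (enum 'I_n) I.
Proof. by rewrite /cl_word /word [index_enum _]unlock -enumT. Qed.

Lemma cl_wordM1 I j :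
  cl_word I * g j = (-1) ^+ inversions I [set j] * cl_word (symd I [set j]).
Proof.
rewrite !wordE word_mul1 ?mem_enum //; congr (_ ^+ _ * _).
rewrite -size_filter -(card_uniqP _) ?filter_uniq ?enum_uniq //.
rewrite /inversions -(card_imset _ (_ : injective (fun i : 'I_n => (i, j)))).
  apply: eq_card => -[i k]; rewrite !inE /=; apply/imsetP/andP.
    by move=> [l]; rewrite mem_filter => /andP[/andP[lI jl] _] [-> ->]; rewrite lI eqxx.
  move=> [/andP[iI /eqP->] ji]; exists i => //.
  by rewrite mem_filter iI ji mem_enum.
  by move=> i k [].
by rewrite -enumT enum_uniq.
Qed.

Lemma cl_wordM I J :
  cl_word I * cl_word J = (-1) ^+ inversions I J * cl_word (symd I J).
Proof.
have [s sE] : exists s, s = enum 'I_n by eexists.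
have -> : J = [set i in J | i \in s].
  by apply/setP=> i; rewrite inE sE mem_enum andbT.
have -> : cl_word [set i in J | i \in s] = word s J.
  by rewrite wordE /word sE; apply: eq_bigl => i; rewrite inE mem_enum andbT.
have := sorted_enum; rewrite -sE; elim/last_ind: s {sE} => [|s j IHs] srt.
  rewrite /word big_nil mulr1 (_ : [set _ in _ | _] = set0).
    by rewrite inversions0r symd0 mul1r.
  by apply/setP=> i; rewrite !inE in_nil andbF.
have [srts sj] : sorted lt_ord s /\ all (lt_ord^~ j) s.
  move: srt; rewrite (sorted_pairwise lt_ord_trans) pairwise_rcons.
  by rewrite -(sorted_pairwise lt_ord_trans) => /andP[].
have jnots : j \notin s by apply/negP=> /(allP sj); rewrite /lt_ord ltnn.
rewrite /word -cats1 big_cat big_cons big_nil /= -/(word s J).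
case: ifP => jJ; last first.
  rewrite mulr1 IHs //; suff -> : [set i in J | i \in s ++ [:: j]] = [set i in J | i \in s] by [].
  apply/setP=> i; rewrite !inE mem_cat mem_seq1.
  by case: (i =P j) => [->|]; rewrite ?jJ ?orbF.
set K := [set i in J | i \in s].
have -> : [set i in J | i \in s ++ [:: j]] = symd K [set j].
  apply/setP=> i; rewrite in_symd !inE mem_cat mem_seq1.
  by case: (i =P j) => [->|]; rewrite ?jJ ?(negPf jnots) ?orbF ?addbF.
rewrite /= mulr1 mulrA IHs // -mulrA cl_wordM1 symdA mulrA -exprD; congr (_ * _).
have signE p q : odd p = odd q -> (-1) ^+ p = (-1) ^+ q :> A.
  by move=> E; rewrite -signr_odd E signr_odd.
apply: signE; rewrite oddD odd_inversionsDl odd_inversionsDr.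
suff -> : inversions K [set j] = 0%N by rewrite addbF.
apply/eqP; rewrite cards_eq0; apply/eqP/setP=> -[i k]; rewrite !inE /=.
case: (k =P j) => [->|]; rewrite ?andbF //.
case: (boolP (i \in s)) => [/(allP sj)|]; rewrite ?andbF // /lt_ord => /ltnW.
by rewrite leqNgt => /negPf->; rewrite andbF.
Qed.

End CliffordWords.

Section SpinRepresentation.
Variable R : realType.
Local Notation C := (complex R).

Fixpoint spin_dim (k : nat) : nat :=
  if k is k'.+1 then spin_dim k' + spin_dim k' else 1.

Lemma spin_dimE k : spin_dim k = (2 ^ k)%N.
Proof. by elim: k => //= k ->; rewrite expnS mul2n addnn. Qed.

(* The Brauer-Weyl gamma matrices g_0, ..., g_2k, of size 2^k: in terms of the
   Pauli matrices, they are sigma_x (x) g'_i for i < 2k-1, then sigma_y (x) 1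
   and sigma_z (x) 1, where g' is the family of size 2^(k-1). *)
Fixpoint spin_gamma (k i : nat) : 'M[C]_(spin_dim k) :=
  match k return 'M[C]_(spin_dim k) with
  | 0 => 1%:M
  | k'.+1 =>
      if (i < k'.*2.+1)%N then block_mx 0 (spin_gamma k' i) (spin_gamma k' i) 0
      else if i == k'.*2.+1 then block_mx 0 (- 'i%C)%:M 'i%C%:M 0
      else block_mx 1%:M 0 0 (- 1)%:M
  end.

Lemma spin_gamma2 k i : spin_gamma k i *m spin_gamma k i = 1%:M.
Proof.
elim: k i => [|k IHk] i /=; first by rewrite mulmx1.
have ii : 'i%C * 'i%C = -1 :> C by rewrite -expr2 sqr_i.
case: ifP => _; last case: ifP => _; rewrite mulmx_block ?mul0mx ?mulmx0
  ?add0r ?addr0 -?scalar_mxM ?IHk ?mulNr ?mulrN ?ii ?opprK ?mulr1 ?mulmx1;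
  by rewrite -scalar_mx_block.
Qed.

Lemma spin_gammaC k i j : (i < k.*2.+1)%N -> (j < k.*2.+1)%N -> i != j ->
  spin_gamma k i *m spin_gamma k j = - (spin_gamma k j *m spin_gamma k i).
Proof.
wlog ij : i j / (i < j)%N.
  move=> H ik jk ne; have := ne; rewrite neq_ltn => /orP[lt|lt]; first exact: H.
  by rewrite (H j i) ?opprK // eq_sym.
move=> _ jk _; elim: k i j ij jk => [|k IHk] i j ij; first by case: j ij.
rewrite doubleS /= => jk.
have [jk'|jk'] := boolP (j < k.*2.+1)%N.
  have ik' := ltn_trans ij jk'.
  rewrite ik' !mulmx_block ?mul0mx ?mulmx0 ?add0r ?addr0 (IHk i j) //.
  by rewrite opp_block_mx !oppr0.
have [jE|jk2] := eqVneq j k.*2.+1.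
  have ik' : (i < k.*2.+1)%N by rewrite -jE.
  rewrite ik' !mulmx_block ?mul0mx ?mulmx0 ?add0r ?addr0.
  by rewrite opp_block_mx !oppr0 !mul_mx_scalar !mul_scalar_mx scaleNr opprK.
have [ik'|ik'] := boolP (i < k.*2.+1)%N.
  rewrite !mulmx_block ?mul0mx ?mulmx0 ?add0r ?addr0.
  rewrite opp_block_mx !oppr0 !mul_mx_scalar !mul_scalar_mx !scaleN1r !scale1r.
  by rewrite opprK.
have -> : i == k.*2.+1 by lia.
rewrite !mulmx_block ?mul0mx ?mulmx0 ?add0r ?addr0 opp_block_mx !oppr0.
rewrite !mul1mx !mulmx1 -!scalar_mxM !mulrN1 !mulN1r.
by rewrite -!raddfN /= !opprK.
Qed.

(* The (complex) Clifford module of dimension 2^(n./2) in which e_i acts as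
   the i-th gamma matrix. For odd n, its restriction to Spin(n) is the spin
   representation S; the two Clifford modules of this dimension (g_i and - g_i)
   have the same restriction, as Spin(n) is contained in the even part. *)
Definition spin_rep n (x : clifford n R) : 'M[C]_(spin_dim n./2) :=
  \sum_(I : {set 'I_n})
    (x I)%:C%C *: \prod_(i < n | i \in I) spin_gamma n./2 i.

Section Morphism.
Variable n : nat.
Implicit Types x y : clifford n R.

Lemma spin_rep1 : spin_rep (1 : clifford n R) = 1%:M.
Proof.
rewrite /spin_rep (bigD1 set0) //= [X in _ + X]big1 => [|I I0]; last first.
  by rewrite cl_basisE (negPf I0) scale0r.
rewrite addr0 cl_basisE eqxx scale1r [LHS]big_pred0 // => i.
by rewrite in_set0.
Qed.

Lemma spin_repM x y : spin_rep (x * y) = spin_rep x *m spin_rep y.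
Proof.
pose g (i : 'I_n) : 'M[C]_(spin_dim n./2) := spin_gamma n./2 i.
have g2 i : g i * g i = 1 by apply: spin_gamma2.
have nk (i : 'I_n) : (i < n./2.*2.+1)%N by have := ltn_ord i; lia.
have gC i j : i != j -> g i * g j = - (g j * g i).
  by move=> ij; apply: spin_gammaC.
have WM := cl_wordM g2 gC.
rewrite /spin_rep mulmx_suml.
under [RHS]eq_bigr => I _ do rewrite mulmx_sumr (reindex_inj (inv_inj (symdK I))).
rewrite exchange_big /=; apply: eq_bigr => K _.
rewrite cl_mul_coef rmorph_sum scaler_suml; apply: eq_bigr => I _.
rewrite -scalemxAl -scalemxAr scalerA -[_ *m _]/(cl_word g I * cl_word g (symd I K)).
rewrite WM symdK -[\prod_(_ | _) _]/(cl_word g K) /cl_sign.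
rewrite !rmorphM rmorphXn rmorphN1 /= mulrC.
have signE p (W : 'M[C]_(spin_dim n./2)) : (-1) ^+ p * W = (-1) ^+ p *: W.
  elim: p => [|p IHp]; first by rewrite !expr0 mul1r scale1r.
  by rewrite !exprS !mulN1r mulNr scaleNr IHp.
by rewrite signE scalerA.
Qed.

End Morphism.
End SpinRepresentation.

Section Groups.
Variable Gamma : groupType.

Definition unacceptable (G : groupType) (r : {multiplicative Gamma -> G}) :=
  exists r' : {multiplicative Gamma -> G},
    (forall gamma, exists g, r' gamma = (r gamma ^ g)%g) /\
    ~ (exists g, forall gamma, r' gamma = (r gamma ^ g)%g).

(* A character with values in {1, -1} has order 2 as soon as it is nontrivial. *)
Definition order2_character (eta : Gamma -> int) :=
  [/\ forall g h, eta (g * h)%g = eta g * eta h,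
      forall g, eta g = 1 \/ eta g = -1 &
      exists g, eta g <> 1].

Variables (K : fieldType) (d : nat).
Implicit Types rho : Gamma -> 'M[K]_d.

(* The module defined by rho is the space of column vectors. *)
Definition rep_iso rho1 rho2 :=
  exists2 P, P \in unitmx & forall gamma, P *m rho1 gamma = rho2 gamma *m P.

Definition rep_twist (eta : Gamma -> int) rho gamma : 'M[K]_d :=
  (eta gamma)%:~R *: rho gamma.

(* Subspaces are row spaces, hence the transpositions: gamma maps the vector
   whose coordinates are the row v to v *m (rho gamma)^T. *)
Definition submodule rho (V : 'M[K]_d) :=
  forall gamma, stablemx V (rho gamma)^T.

Definition submodule_det rho (V : 'M[K]_d) gamma : K :=
  \det (restrictmx V (rho gamma)^T).

End Groups.

(* Main.v *)
Require Import Defs.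
From HB Require Import structures.
From mathcomp Require Import all_boot all_order all_algebra.
From mathcomp Require Import boolp reals.
From mathcomp Require Import complex zify ring.
Set Implicit Arguments.
Unset Strict Implicit.
Unset Printing Implicit Defensive.
Import Order.TTheory GRing.Theory Num.Theory.
Local Open Scope ring_scope.

(** Suppose that r' is elementwise conjugate to r. The orthogonal
    representations defined by r and r' on E have the same trace, so they are
    conjugate under O(n) ([orthogonal_equivalence]); as Gamma is arbitrary, the
    averaging of finite or compact groups is replaced there by orthogonal
    projections in spaces of matrices. As n is odd, O(n) is generated by
    SO(n) and the central element -1, hence every orthogonal matrix is, up to
    sign, the image of an element u of Spin(n) ([spin_mx_surjective]). After
    conjugation by u, the morphisms r and r' have the same image in SO(n), so
    r' = eta r for a sign character eta ([spin_mx_eq]). The representations S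
    and S (x) eta then have the same trace, and are isomorphic by
    [unitary_equivalenceC]. If a submodule V of E had determinant eta, the
    volume element y of V, that is, the Clifford product of an orthonormal
    basis, would satisfy x y x^-1 = det (x | V) y for x in r(Gamma)
    ([spin_conj_stable_frame]); corrected by a power of the central volume
    element of E, it lies in Spin(n) and conjugates r to eta r, so that r and
    r' would be conjugate.

    Conversely, let r' = eta r. The trace of S on an even element is 2^k times
    its scalar coefficient ([tr_spin_rep]). The key fact is
    [cl_scalar_part_neq0]: an element x of Spin(n) whose scalar coefficient
    vanishes has the eigenvalue -1 in SO(n). So if eta gamma = -1, then S and
    S (x) eta being isomorphic, r gamma has trace 0 and sends some unit vector
    u to - u; the half-turn fixing u then conjugates r gamma to - r gamma.
    Finally, suppose that r' is the conjugate of r by g in Spin(n). Take for V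
    the eigenspace of g for the eigenvalue -1, and for y its volume element.
    The vectors of V are no longer reversed by y g, so [cl_scalar_part_neq0]
    applies to it, and its scalar coefficient is not 0. But conjugation by
    r gamma multiplies y by det (gamma | V) and g by eta gamma, and does not
    change the scalar coefficient of y g; hence V has determinant eta. *)

(** * Adjoints and orthogonal projections *)

(** The condition on conj covers both the identity of a real field and the
    conjugation of a complex one. *)
Section Adjoint.
Variables (K : numFieldType) (conj : {rmorphism K -> K}).
Hypothesis mul_conj : forall x, x * conj x = `|x| ^+ 2.

Definition adjoint m n (A : 'M[K]_(m, n)) : 'M[K]_(n, m) := (map_mx conj A)^T.

Lemma conj_nneg a : 0 <= a -> conj a = a.
Proof.
have [->|a0 age] := eqVneq a 0; first by rewrite rmorph0.
by apply: (mulfI a0); rewrite mul_conj ger0_norm ?expr2.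
Qed.

Lemma conj_involutive : involutive conj.
Proof.
move=> x; have [->|x0] := eqVneq x 0; first by rewrite !rmorph0.
have cx0 : conj x != 0 by rewrite fmorph_eq0.
apply: (mulfI cx0); rewrite -rmorphM mul_conj (conj_nneg (exprn_ge0 _ (normr_ge0 _))).
by rewrite -mul_conj mulrC.
Qed.

Lemma adjointK m n (A : 'M_(m, n)) : adjoint (adjoint A) = A.
Proof. by apply/matrixP=> i j; rewrite !mxE conj_involutive. Qed.

Lemma adjM m n p (A : 'M_(m, n)) (B : 'M_(n, p)) :
  adjoint (A *m B) = adjoint B *m adjoint A.
Proof. by rewrite /adjoint map_mxM trmx_mul. Qed.

Lemma adjD m n (A B : 'M_(m, n)) : adjoint (A + B) = adjoint A + adjoint B.
Proof. by rewrite /adjoint map_mxD raddfD. Qed.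

Lemma adjB m n (A B : 'M_(m, n)) : adjoint (A - B) = adjoint A - adjoint B.
Proof. by rewrite /adjoint map_mxB raddfB. Qed.

Lemma adj1 n : adjoint 1%:M = 1%:M :> 'M_n.
Proof. by rewrite /adjoint map_mx1 trmx1. Qed.

Lemma adj0 m n : adjoint 0 = 0 :> 'M_(m, n).
Proof. by rewrite /adjoint map_mx0 trmx0. Qed.

Lemma adjZ m n a (A : 'M_(m, n)) : adjoint (a *: A) = conj a *: adjoint A.
Proof. by rewrite /adjoint map_mxZ linearZ. Qed.

Lemma tr_adj m n (A : 'M_(m, n)) : \tr (A *m adjoint A) = \sum_i \sum_j `|A i j| ^+ 2.
Proof.
by apply: eq_bigr => i _; rewrite !mxE; apply: eq_bigr => j _; rewrite !mxE mul_conj.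
Qed.

Lemma tr_adj_ge0 m n (A : 'M_(m, n)) : 0 <= \tr (A *m adjoint A).
Proof. by rewrite tr_adj; do 2 (apply: sumr_ge0 => ? _); apply: exprn_ge0. Qed.

Lemma tr_adj_eq0 m n (A : 'M_(m, n)) : \tr (A *m adjoint A) = 0 -> A = 0.
Proof.
rewrite tr_adj => /eqP; rewrite psumr_eq0 => [/allP A0|i _]; last first.
  by apply: sumr_ge0 => ? _; apply: exprn_ge0.
apply/matrixP=> i j; have := A0 i; rewrite mem_index_enum => /(_ isT) /=.
rewrite psumr_eq0 => [/allP /(_ j)|? _]; last exact: exprn_ge0.
by rewrite mem_index_enum => /(_ isT) /=; rewrite expf_eq0 normr_eq0 mxE => /eqP.
Qed.

Lemma mul_adj_eq0 m n (A : 'M_(m, n)) : A *m adjoint A = 0 -> A = 0.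
Proof. by move=> E; apply: tr_adj_eq0; rewrite E mxtrace0. Qed.

(** Since the form is anisotropic, the Gram matrix of a basis B of L is
    invertible, and the projection is B^* (B B^* )^-1 B. *)
Lemma orthogonal_projection m n (L : 'M[K]_(m, n)) :
  exists P : 'M_n, [/\ adjoint P = P, P *m P = P, (P <= L)%MS & L *m P = L].
Proof.
have [r [B [fB BL]]] : exists r (B : 'M[K]_(r, n)), row_free B /\ (B :=: L)%MS.
  by exists (\rank L), (row_base L); split; [apply: row_base_free|apply: eq_row_base].
have uG : B *m adjoint B \in unitmx.
  rewrite -row_free_unit -kermx_eq0; apply/eqP/row_matrixP=> i; rewrite row0.
  set v := row i _; have : v *m (B *m adjoint B) = 0 by rewrite -row_mul mulmx_ker row0.
  move=> v0; have vB0 : v *m B = 0.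
    by apply: mul_adj_eq0; rewrite adjM mulmxA -[v *m B *m _]mulmxA v0 mul0mx.
  by apply: (row_free_inj fB); rewrite vB0 mul0mx.
have [G aG GE] : exists2 G, adjoint G = G & B *m adjoint B *m G = 1%:M.
  exists (invmx (B *m adjoint B)); last exact: mulmxV.
  by rewrite /adjoint map_invmx trmx_inv -/(adjoint (B *m adjoint B)) adjM adjointK.
have /submxP[T LE] : (L <= B)%MS by rewrite BL.
exists (adjoint B *m G *m B); split.
- by rewrite adjM adjM aG adjointK mulmxA.
- by rewrite !mulmxA -[_ *m B *m adjoint B]mulmxA -[_ *m (B *m _) *m G]mulmxA GE mulmx1.
- by rewrite -BL submxMl.
by rewrite {1}LE !mulmxA -[T *m B *m adjoint B]mulmxA -[T *m _ *m G]mulmxA GE mulmx1 -LE.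
Qed.

End Adjoint.

(** The span of an infinite family, obtained as a subspace of minimal rank among
    those that contain the family. *)
Lemma smallest_submx (F : fieldType) (I : Type) n (f : I -> 'rV[F]_n) :
  exists L : 'M_n, (forall i, (f i <= L)%MS) /\
    forall M : 'M_n, (forall i, (f i <= M)%MS) -> (L <= M)%MS.
Proof.
suff H k (L : 'M_n) : (\rank L < k)%N -> (forall i, (f i <= L)%MS) ->
  exists L : 'M_n, (forall i, (f i <= L)%MS) /\
    forall M : 'M_n, (forall i, (f i <= M)%MS) -> (L <= M)%MS.
  by apply: (H n.+1 1%:M); rewrite ?ltnS ?rank_leq_row // => i; rewrite submx1.
elim: k L => // k IHk L Lk fL.
have [Lmin|] := pselect (forall M : 'M_n, (forall i, (f i <= M)%MS) -> (L <= M)%MS).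
  by exists L.
move=> /existsNP[M /not_implyP[fM /negP LM]].
apply: (IHk (L :&: M)%MS) => [|i]; last by rewrite sub_capmx fL fM.
apply: leq_trans (_ : \rank L <= k)%N; last by rewrite -ltnS.
apply: rank_ltmx.
by rewrite ltmxE capmxSl sub_capmx submx_refl.
Qed.

(** * Unitary representations with the same trace *)

Section UnitaryRepresentations.
Variables (K : numFieldType) (conj : {rmorphism K -> K}).
Hypothesis mul_conj : forall x, x * conj x = `|x| ^+ 2.
Local Notation adj := (adjoint conj).
Local Notation adjK := (adjointK mul_conj).
Variable Gamma : groupType.

Definition unitary_rep d (rho : Gamma -> 'M[K]_d) :=
  (forall g h, rho (g * h)%g = rho g *m rho h) /\
  (forall g, rho g *m adj (rho g) = 1%:M).

Definition intertwines d e (rho : Gamma -> 'M[K]_d) (sigma : Gamma -> 'M[K]_e)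
  (X : 'M_(d, e)) := forall g, rho g *m X = X *m sigma g.

Section Basics.
Variables (d : nat) (rho : Gamma -> 'M[K]_d).
Hypothesis rhoU : unitary_rep rho.

Lemma unitary_rep1 : rho 1%g = 1%:M.
Proof.
have [rM rA] := rhoU.
by rewrite -[LHS]mulmx1 -(rA 1%g) mulmxA -rM mulg1 rA.
Qed.

Lemma unitary_repV g : adj (rho g) = rho g^-1%g.
Proof.
have [rM rA] := rhoU.
by rewrite -[LHS]mul1mx -unitary_rep1 -(mulVg g) rM -mulmxA rA mulmx1.
Qed.

End Basics.

Lemma intertwines_adj d e (rho : Gamma -> 'M[K]_d) (sigma : Gamma -> 'M[K]_e) X :
  unitary_rep rho -> unitary_rep sigma ->
  intertwines rho sigma X -> intertwines sigma rho (adj X).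
Proof.
move=> rU sU rX g; have := congr1 (fun A => adj A) (rX g^-1%g).
by rewrite !adjM (unitary_repV rU) (unitary_repV sU) invgK.
Qed.

Lemma intertwinesM d e f (rho : Gamma -> 'M[K]_d) (sigma : Gamma -> 'M[K]_e)
    (tau : Gamma -> 'M[K]_f) X Y :
  intertwines rho sigma X -> intertwines sigma tau Y ->
  intertwines rho tau (X *m Y).
Proof. by move=> rX sY g; rewrite mulmxA rX -mulmxA sY mulmxA. Qed.

(** The orthogonal projection onto the submodule generated by c, for the scalar
    product tr (X Y^* ): it commutes with the group because that submodule is
    stable and the action is unitary. The second property expresses that the
    submodule is spanned by the translates of c. *)
Lemma cyclic_projection d m (rho : Gamma -> 'M[K]_m) (c : 'M[K]_(d, m)) :
  unitary_rep rho ->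
  exists pi : {linear 'M[K]_(d, m) -> 'M[K]_(d, m)},
  [/\ forall g Z, pi (Z *m rho g) = pi Z *m rho g,
      forall k (h : {linear 'M[K]_(d, m) -> 'rV[K]_k}),
        (forall g, h (c *m rho g) = 0) -> forall Z, h (pi Z) = 0 &
      forall Z, \tr ((Z - pi Z) *m adj c) = 0].
Proof.
move=> rU; have [rM rA] := rU.
have [L [cL Lmin]] := smallest_submx (fun g => mxvec (c *m rho g)).
have [P [aP PP PL LP]] := orthogonal_projection mul_conj L.
pose pi := vec_mx \o mulmxr P \o mxvec : 'M[K]_(d, m) -> 'M[K]_(d, m).
have piL Z : (mxvec (pi Z) <= L)%MS.
  by rewrite vec_mxK; apply: submx_trans PL; apply: submxMl.
have Lstab Z g : (mxvec Z <= L)%MS -> (mxvec (Z *m rho g) <= L)%MS.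
  pose M := lin_mx (mulmxr (rho g)) : 'M[K]_(d * m).
  have ME Y : mxvec Y *m M = mxvec (Y *m rho g) by rewrite mul_vec_lin.
  suff LM : (L *m M <= L)%MS.
    by move=> ZL; rewrite -ME; apply: submx_trans LM; apply: submxMr.
  pose M' := lin_mx (mulmxr (rho g^-1%g)) : 'M[K]_(d * m).
  have MM' : M' *m M = 1%:M.
    apply/row_matrixP=> i; rewrite !rowE mulmx1 mulmxA.
    rewrite -(vec_mxK (delta_mx 0 i)) mul_vec_lin ME /= -mulmxA -rM mulVg.
    by rewrite unitary_rep1 // mulmx1.
  (* The image of L under the inverse of rho g also contains the translates
     of c, and L is the smallest such subspace. *)
  have LM' : (L <= L *m M')%MS.
    apply: Lmin => k; have := cL (k * g)%g => /(submxMr M').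
    by rewrite mul_vec_lin /= -mulmxA -rM -mulgA mulgV mulg1.
  by have := submxMr M LM'; rewrite -mulmxA MM' mulmx1.
have dot (A B : 'M[K]_(d, m)) : (mxvec A *m adj (mxvec B)) 0 0 = \tr (A *m adj B).
  rewrite mxE (reindex _ (curry_mxvec_bij _ _)) /=.
  under [RHS]eq_bigr => i _ do rewrite mxE.
  by rewrite pair_bigA; apply: eq_bigr => -[i j] _; rewrite /= !mxE !mxvecE.
have orth Z (W : 'M[K]_(d, m)) : (mxvec W <= L)%MS -> \tr ((Z - pi Z) *m adj W) = 0.
  move=> /submxP[T WE]; rewrite -dot WE -LP mulmxA (adjM conj (T *m L)) aP mulmxA.
  by rewrite linearB /= vec_mxK mulmxBl -mulmxA PP subrr mul0mx mxE.
exists pi; split.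
- move=> g Z; apply/eqP; rewrite -subr_eq0; apply/eqP; apply: (tr_adj_eq0 mul_conj).
  set W := _ - _; have WL : (mxvec W <= L)%MS.
    by rewrite linearB addmx_sub ?eqmx_opp ?Lstab ?piL.
  have WE : W = (Z - pi Z) *m rho g - (Z *m rho g - pi (Z *m rho g)).
    by rewrite mulmxBl /W opprB [RHS]addrC subrKA.
  clearbody W; rewrite {1}WE mulmxBl raddfB /= orth // subr0.
  rewrite -mulmxA -[rho g]adjK -adjM (unitary_repV rU) orth //; exact: Lstab.
- move=> k h h0 Z; pose H := lin1_mx (h \o vec_mx).
  have HE Y : mxvec Y *m H = h Y by rewrite mul_rV_lin1 /= mxvecK.
  suff /(submx_trans (piL Z)) /sub_kermxP : (L <= kermx H)%MS by rewrite HE.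
  by apply: Lmin => g; apply/sub_kermxP; rewrite HE.
by move=> Z; apply: orth; have := cL 1%g; rewrite unitary_rep1 // mulmx1.
Qed.

Section SameTrace.
Variables (d : nat) (rho sigma : Gamma -> 'M[K]_d).
Hypotheses (rhoU : unitary_rep rho) (sigmaU : unitary_rep sigma).

(** Project (p, 0) to (a, b) in the submodule generated by (p, q). If no
    intertwiner from p to q were nonzero, b would vanish; but a and b have the
    same trace, so tr a = 0, and since (p - a, - b) is orthogonal to (p, q) this
    gives tr (p p^* ) = 0. *)
Lemma exists_intertwiner (p q : 'M[K]_d) :
    adj p = p -> p *m p = p -> adj q = q -> q *m q = q ->
    intertwines rho rho p -> intertwines sigma sigma q ->
    (forall g, \tr (p *m rho g) = \tr (q *m sigma g)) -> p != 0 ->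
  exists2 X, intertwines rho sigma X & p *m X *m q != 0.
Proof.
move=> ap pp aq qq rp sq trE p0; apply: contrapT => noX.
have X0 X : intertwines rho sigma X -> p *m X *m q = 0.
  by move=> XI; apply/eqP; apply: contrapT => /negP pXq; apply: noX; exists X.
pose G g := block_mx (rho g) 0 0 (sigma g).
have GU : unitary_rep G.
  have [[rM rA] [sM sA]] := (rhoU, sigmaU); split=> [g h|g].
    by rewrite mulmx_block !mul0mx !mulmx0 !(addr0, add0r) /G rM sM.
  rewrite /adjoint /G map_block_mx tr_block_mx mulmx_block.
  rewrite !map_mx0 !trmx0 !mul0mx !mulmx0 !(addr0, add0r).
  by rewrite -/(adj (rho g)) -/(adj (sigma g)) rA sA -scalar_mx_block.
have rowG (a b : 'M_d) g : row_mx a b *m G g = row_mx (a *m rho g) (b *m sigma g).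
  by rewrite mul_row_block !mulmx0 addr0 add0r.
have [pi [piG piL piO]] := cyclic_projection (row_mx p q) GU.
have piq (Z : 'M_d) : Z *m p = Z -> rsubmx (pi (row_mx Z 0)) *m q = 0.
  move=> Zp; apply/row_matrixP=> i; rewrite row_mul row0.
  (* For each j, X j sends a row vector u to the i-th row of the second
     component of the image of the matrix whose only nonzero row is u. *)
  pose X j : 'M_d := lin1_mx (row i \o rsubmx \o pi \o
    mulmxr (row_mx 1%:M 0) \o mulmx (delta_mx j 0 : 'cV_d)).
  have inlE (W : 'M_d) : W *m row_mx 1%:M 0 = row_mx W 0 :> 'M_(d, d + d).
    by rewrite mul_mx_row mulmx1 mulmx0.
  have XE j (u : 'rV_d) :
      u *m X j = row i (rsubmx (pi (row_mx (delta_mx j 0 *m u) 0))).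
    by rewrite mul_rV_lin1 /= inlE.
  have XI j : intertwines rho sigma (X j).
    move=> g; apply/row_matrixP=> k; rewrite !rowE !mulmxA !XE mulmxA.
    rewrite -[X in row_mx _ X](mul0mx _ (sigma g)) -rowG piG.
    by rewrite -[pi (row_mx _ 0)]hsubmxK rowG !row_mxKr row_mul.
  have -> : row i (rsubmx (pi (row_mx Z 0))) = \sum_j row j Z *m X j.
    under eq_bigr => j _ do rewrite XE -inlE.
    rewrite -!linear_sum -mulmx_suml /= inlE; congr (row i (rsubmx (pi (row_mx _ _)))).
    apply/matrixP=> k l; rewrite summxE (bigD1 k) //= big1 ?addr0 => [|j jk].
      by rewrite mxE big_ord1 !mxE !eqxx mul1r.
    by rewrite mxE big_ord1 !mxE eq_sym (negPf jk) mul0r.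
  rewrite mulmx_suml big1 // => j _.
  by rewrite -Zp row_mul -!mulmxA [p *m _]mulmxA X0 ?mulmx0.
have [a [b ab]] : exists a b, pi (row_mx p 0) = row_mx a b.
  by exists (lsubmx (pi (row_mx p 0))), (rsubmx (pi (row_mx p 0))); rewrite hsubmxK.
have rowvec (h : {linear 'M[K]_(d, d + d) -> 'M[K]_d}) :
    (forall g, h (row_mx p q *m G g) = 0) -> h (row_mx a b) = 0.
  move=> h0; apply: (can_inj mxvecK); rewrite linear0 -ab.
  by apply: (piL _ (mxvec \o h)) => g /=; rewrite h0 linear0.
have b0 : b = 0.
  have := piq p pp; rewrite ab row_mxKr => bq; rewrite -bq; apply/subr0_eq.
  have := rowvec (idfun \- mulmxr q \o rsubmx); rewrite /= row_mxKr; apply=> g.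
  by rewrite rowG row_mxKr -mulmxA sq mulmxA qq subrr.
have pa : a *m p = a.
  apply/subr0_eq; have := rowvec (mulmxr p \o lsubmx \- lsubmx).
  rewrite /= row_mxKl; apply=> g.
  by rewrite rowG row_mxKl -mulmxA rp mulmxA pp subrr.
have tr_ab : \tr a = \tr b.
  pose f (M : 'M[K]_(d, d + d)) : 'rV_1 := (\tr (lsubmx M) - \tr (rsubmx M))%:M.
  have flin : linear f.
    move=> k M N; rewrite /f !linearP /= scale_scalar_mx -raddfD /=; congr (_%:M).
    by rewrite mulrBr opprD addrACA.
  pose F : {linear 'M[K]_(d, d + d) -> 'rV[K]_1} :=
    HB.pack f (GRing.isLinear.Build _ _ _ _ f flin).
  have /(congr1 (fun M : 'rV_1 => M 0 0)) : f (row_mx a b) = 0.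
    rewrite -ab; apply: (piL _ F) => g; rewrite /= /f rowG row_mxKl row_mxKr trE.
    by rewrite subrr raddf0.
  by rewrite /f row_mxKl row_mxKr !mxE mulr1n => /subr0_eq.
have := piO (row_mx p 0).
rewrite ab b0 opp_row_mx add_row_mx subrr {1}/adjoint map_row_mx tr_row_mx mul_row_col.
rewrite mul0mx addr0 -/(adj p) ap mulmxBl pp raddfB /= pa tr_ab b0.
rewrite mxtrace0 subr0 -pp -{2}ap => /(tr_adj_eq0 mul_conj) /eqP.
by rewrite (negPf p0).
Qed.

Hypothesis conj_sqrt : forall a, 0 <= a -> exists s, s * conj s = a.
Hypothesis hermitian_eigenvalue : forall m (H : 'M[K]_m.+1),
  adj H = H -> H != 0 -> exists2 a, a != 0 & eigenvalue H a.

End SameTrace.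

(** Eigenprojections of hermitian matrices are built as polynomials in the
    matrix, so that they commute with the group as soon as the matrix does. *)
Section EigenProjection.
Variables (n : nat) (H : 'M[K]_n.+1).
Hypothesis aH : adj H = H.

Lemma adj_horner (f : {poly K}) :
  adj (horner_mx H f) = horner_mx H (map_poly conj f).
Proof.
elim/poly_ind: f => [|f c IHf]; first by rewrite !rmorph0 adj0.
rewrite !rmorphD !rmorphM /= !map_polyX !map_polyC /= !horner_mx_X !horner_mx_C.
rewrite adjD adjM IHf aH; congr (_ + _).
  by rewrite comm_mx_horner //; apply: comm_mx_refl.
by rewrite /adjoint map_scalar_mx tr_scalar_mx.
Qed.

(** A hermitian matrix and its powers have the same kernel: if M M y = 0 then
    (M y)^* (M y) = 0. *)
Lemma hermitian_exp_eq0 (M x : 'M[K]_n.+1) k :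
  adj M = M -> M ^+ k.+1 * x = 0 -> M * x = 0.
Proof.
move=> aM; elim: k x => // k IHk x MMx0; apply: IHk; rewrite exprS -mulrA.
set y := _ * x; have My0 : M * (M * y) = 0 by rewrite -MMx0 !exprS !mulrA.
suff: adj (M * y) = 0 by move/(congr1 (fun A => adj A)); rewrite adjK adj0.
apply: (mul_adj_eq0 mul_conj).
by rewrite adjK adjM aM -mulmxA [M *m _]My0 mulmx0.
Qed.

Lemma horner_eigenvector m (V : 'M[K]_(m, n.+1)) a (f : {poly K}) :
  V *m H = a *: V -> V *m horner_mx H f = f.[a] *: V.
Proof.
move=> VH; elim/poly_ind: f => [|f c IHf].
  by rewrite rmorph0 horner0 mulmx0 scale0r.
rewrite rmorphD rmorphM /= horner_mx_X horner_mx_C hornerMXaddC mulmxDr mulmxA.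
by rewrite IHf -scalemxAl VH mul_mx_scalar scalerA scalerDl.
Qed.

(** Write the characteristic polynomial as (X - a)^m g with g(a) <> 0. Then
    (H - a)^m g(H) = 0, hence (H - a) g(H) = 0, and g(H) / g(a) is the
    projection. *)
Lemma eigen_projection a : a != 0 -> conj a = a -> eigenvalue H a ->
  exists e, [/\ adj e = e, e *m e = e, e *m H = a *: e, e != 0 &
    forall B, comm_mx B H -> comm_mx B e].
Proof.
move=> a0 ca; rewrite eigenvalue_root_char => rootHa.
have [m [g ga charE]] := multiplicity_XsubC (char_poly H) a.
have {}ga : g.[a] != 0 by rewrite (negPf (monic_neq0 (char_poly_monic H))) in ga.
case: m charE => [charE|m charE].
  by move: rootHa; rewrite charE expr0 mulr1 rootE (negPf ga).
have gH : horner_mx H g *m H = a *: horner_mx H g.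
  apply/subr0_eq; rewrite -mul_mx_scalar -mulmxBr.
  have -> : horner_mx H g *m (H - a%:M) = (H - a%:M) * horner_mx H g.
    rewrite -[H in H - _]horner_mx_X -(horner_mx_C H) -rmorphB.
    exact: comm_horner_mx2.
  apply: (@hermitian_exp_eq0 _ _ m).
    by rewrite adjB aH /adjoint map_scalar_mx tr_scalar_mx ca.
  rewrite -[H in H - _]horner_mx_X -(horner_mx_C H) -rmorphB -rmorphXn -rmorphM.
  by rewrite [_ * g]mulrC -charE; apply: Cayley_Hamilton.
pose f := g.[a]^-1 *: g; have fa : f.[a] = 1 by rewrite hornerZ mulVf.
have eH : horner_mx H f *m H = a *: horner_mx H f.
  by rewrite /f horner_mxZ -scalemxAl gH !scalerA mulrC.
have ee := horner_eigenvector f eH; rewrite fa scale1r in ee.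
exists (horner_mx H f); split=> //; last by move=> B BH; apply: comm_mx_horner.
  have := horner_eigenvector (map_poly conj f) eH.
  rewrite -[X in _.[X] *: _]ca horner_map fa rmorph1 scale1r -adj_horner => E.
  by rewrite -[in RHS]E -[in LHS]E adjM adjK.
move: rootHa; rewrite -eigenvalue_root_char => /eigenvalueP[v vH v0].
apply: contraNneq v0 => e0; have := horner_eigenvector f vH.
by rewrite e0 mulmx0 fa scale1r => <-.
Qed.

End EigenProjection.

Section Equivalence.
Hypothesis conj_sqrt : forall a, 0 <= a -> exists s, s * conj s = a.
Hypothesis hermitian_eigenvalue : forall m (H : 'M[K]_m.+1),
  adj H = H -> H != 0 -> exists2 a, a != 0 & eigenvalue H a.

(** A partial isometry T of maximal rank among the intertwiners is unitary.
    Otherwise 1 - T T^* is a nonzero projection with the same trace against the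
    group as 1 - T^* T, so there is a nonzero intertwiner X between them; a
    multiple of X, cut down to an eigenspace of X X^*, is a partial isometry
    that can be added to T. *)
Theorem unitary_equivalence d (rho sigma : Gamma -> 'M[K]_d) :
    unitary_rep rho -> unitary_rep sigma ->
    (forall g, \tr (rho g) = \tr (sigma g)) ->
  exists2 U, U *m adj U = 1%:M & intertwines rho sigma U.
Proof.
case: d rho sigma => [|d] rho sigma rU sU trE.
  by exists 0; [|move=> g]; apply/matrixP; case.
suff H m (T : 'M_d.+1) : (d.+1 - \rank T < m)%N -> T *m adj T *m T = T ->
    intertwines rho sigma T -> exists2 U, U *m adj U = 1%:M & intertwines rho sigma U.
  apply: (H _ 0 (ltnSn _)); first by rewrite mulmx0.
  by move=> g; rewrite mulmx0 mul0mx.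
elim: m T => // m IHm T Tm TTT TI.
have TaI := intertwines_adj rU sU TI.
pose p := 1%:M - T *m adj T; pose q := 1%:M - adj T *m T.
have TaTT : adj T *m T *m adj T = adj T.
  by rewrite -mulmxA -[RHS](congr1 (fun M => adj M) TTT) !adjM adjK.
have ap : adj p = p by rewrite adjB adj1 adjM adjK.
have aq : adj q = q by rewrite adjB adj1 adjM adjK.
have pT : p *m T = 0 by rewrite mulmxBl mul1mx TTT subrr.
have qT : q *m adj T = 0 by rewrite mulmxBl mul1mx TaTT subrr.
have pp : p *m p = p by rewrite {2}/p mulmxBr mulmx1 mulmxA pT mul0mx subr0.
have qq : q *m q = q by rewrite {2}/q mulmxBr mulmx1 mulmxA qT mul0mx subr0.
have pI : intertwines rho rho p.
  by move=> g; rewrite mulmxBl mulmxBr mulmx1 mul1mx (intertwinesM TI TaI).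
have qI : intertwines sigma sigma q.
  by move=> g; rewrite mulmxBl mulmxBr mulmx1 mul1mx (intertwinesM TaI TI).
have [p0|p0] := eqVneq p 0.
  by exists T => //; apply/esym/subr0_eq.
have trpq g : \tr (p *m rho g) = \tr (q *m sigma g).
  rewrite !mulmxBl !mul1mx !raddfB /= trE; congr (_ - _).
  by rewrite -mulmxA -TaI mxtrace_mulC -mulmxA mxtrace_mulC.
have [X0 X0I X0n] := exists_intertwiner rU sU ap pp aq qq pI qI trpq p0.
pose X := p *m X0 *m q; have XI : intertwines rho sigma X.
  exact: intertwinesM (intertwinesM pI X0I) qI.
pose H := X *m adj X; have aH : adj H = H by rewrite adjM adjK.
have H0 : H != 0 by apply: contraNneq X0n => /(mul_adj_eq0 mul_conj)/eqP.
have [a a0 Ha] := hermitian_eigenvalue aH H0.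
have age0 : 0 <= a.
  have /eigenvalueP[v vH v0] := Ha.
  have vv0 : 0 < \tr (v *m adj v).
    rewrite lt0r tr_adj_ge0 // andbT; apply: contra v0 => /eqP.
    by move/(tr_adj_eq0 mul_conj)->.
  rewrite -(pmulr_lge0 _ vv0) -mxtraceZ scalemxAl -vH.
  have -> : v *m H *m adj v = (v *m X) *m adj (v *m X) by rewrite adjM !mulmxA.
  exact: tr_adj_ge0.
have [e [ae ee eH e0 eC]] := eigen_projection aH a0 (conj_nneg mul_conj age0) Ha.
have [s sE] := conj_sqrt age0.
have s0 : s != 0 by apply: contraNneq a0 => s0; rewrite -sE s0 mul0r.
have HI : intertwines rho rho H := intertwinesM XI (intertwines_adj rU sU XI).
have He : H *m e = a *: e.
  rewrite -[in RHS]ae -[in LHS]ae -[in LHS]aH -adjM.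
  by rewrite -[in RHS](conj_nneg mul_conj age0) -adjZ eH.
have pe : p *m e = e.
  apply: (scalerI a0); rewrite scalemxAr -He mulmxA; congr (_ *m _).
  by rewrite /H /X !mulmxA pp.
pose Y := s^-1 *: (e *m X).
have YI : intertwines rho sigma Y.
  move=> g; rewrite -scalemxAr -scalemxAl mulmxA; congr (_ *: _).
  by rewrite (eC _ (HI g)) -[LHS]mulmxA XI mulmxA.
have YYa : Y *m adj Y = e.
  rewrite adjZ adjM ae -scalemxAl -scalemxAr scalerA fmorphV -invfM sE.
  by rewrite -mulmxA [X *m _]mulmxA -/H mulmxA eH -scalemxAl ee scalerK.
have eY : e *m Y = Y by rewrite -scalemxAr mulmxA ee.
have pY : p *m Y = Y by rewrite -eY mulmxA pe.
have Yq : Y *m q = Y.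
  rewrite -scalemxAl; congr (_ *: _); rewrite -mulmxA; congr (_ *m _).
  by rewrite /X -[LHS]mulmxA qq.
have YTa : Y *m adj T = 0 by rewrite -Yq -mulmxA qT mulmx0.
have TaY : adj T *m Y = 0.
  have Tap := congr1 (fun A => adj A) pT; rewrite adjM ap adj0 in Tap.
  by rewrite -pY mulmxA Tap mul0mx.
have TYa : T *m adj Y = 0 by rewrite -[LHS]adjK adjM adjK YTa adj0.
have YaT : adj Y *m T = 0 by rewrite -[LHS]adjK adjM adjK TaY adj0.
have Y0 : Y != 0.
  by apply: contraNneq e0 => Y0; rewrite -YYa Y0 mul0mx.
apply: (IHm (T + Y)).
- have TE : T = T *m adj T *m (T + Y) by rewrite mulmxDr TTT -mulmxA TaY mulmx0 addr0.
  have TTY : (T < (T + Y)%R)%MS.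
    have leT : (T <= (T + Y)%R)%MS by rewrite [X in (X <= _)%MS]TE submxMl.
    rewrite ltmxE leT; apply/negP=> TY.
    have /submxP[D DE] : (Y <= T)%MS.
      apply: submx_trans TY; rewrite -{1}eY -YYa.
      suff -> : Y *m adj Y *m Y = Y *m adj Y *m (T + Y) by apply: submxMl.
      by rewrite mulmxDr -[Y *m _ *m T]mulmxA YaT mulmx0 add0r.
    by case/eqP: e0; rewrite -YYa {1}DE -mulmxA TYa mulmx0.
  have := rank_ltmx TTY; have := rank_leq_row (T + Y)%R; lia.
- have -> : (T + Y) *m adj (T + Y) = T *m adj T + e.
    by rewrite adjD mulmxDl !mulmxDr YTa TYa addr0 add0r YYa.
  rewrite mulmxDl !mulmxDr TTT eY -YYa -!mulmxA TaY YaT !mulmx0 addr0 add0r.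
  by [].
by move=> g; rewrite mulmxDr mulmxDl TI YI.
Qed.

End Equivalence.
End UnitaryRepresentations.

(** * The complex and the real case *)

Section RealComplex.
Variable R : realType.
Local Notation C := (complex R).

Lemma mul_conj_norm (x : C) : x * Num.conj x = `|x| ^+ 2.
Proof. by rewrite normCK. Qed.

Lemma mul_id_norm (x : R) : x * idfun x = `|x| ^+ 2.
Proof. by rewrite real_normK ?num_real // expr2. Qed.

Lemma conj_sqrtC (a : C) : 0 <= a -> exists s, s * Num.conj s = a.
Proof.
move=> a0; exists (sqrtC a); rewrite conj_Creal ?ger0_real ?sqrtC_ge0 //.
by rewrite -expr2 sqrtCK.
Qed.

Lemma id_sqrtR (a : R) : 0 <= a -> exists s, s * idfun s = a.
Proof. by move=> a0; exists (Num.sqrt a); rewrite -expr2 sqr_sqrtr. Qed.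

(** Compare v H v^* with its adjoint, v being an eigenvector. *)
Lemma hermitian_eigenvalue_conj (K : numFieldType) (conj : {rmorphism K -> K})
    n (H : 'M[K]_n) a :
  (forall x, x * conj x = `|x| ^+ 2) -> adjoint conj H = H -> eigenvalue H a -> conj a = a.
Proof.
move=> mul_conj aH /eigenvalueP[v vH v0].
have vv0 : \tr (v *m adjoint conj v) != 0.
  by apply: contra v0 => /eqP/(tr_adj_eq0 mul_conj)->.
apply: (mulIf vv0); rewrite -!mxtraceZ [in RHS]scalemxAl -vH.
have trA (M : 'M[K]_1) : \tr (adjoint conj M) = conj (\tr M).
  by rewrite /mxtrace !big_ord1 !mxE.
have <- : adjoint conj (v *m H *m adjoint conj v) = v *m H *m adjoint conj v.
  by rewrite !adjM adjointK // aH mulmxA.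
rewrite trA vH -scalemxAl !mxtraceZ rmorphM /= -trA adjM adjointK //.
Qed.

(** If all roots of the characteristic polynomial were 0, then H would be
    nilpotent, hence 0. *)
Lemma hermitian_eigenC m (H : 'M[C]_m.+1) :
  adjoint Num.conj H = H -> H != 0 -> exists2 a, a != 0 & eigenvalue H a.
Proof.
move=> aH H0; have [r rE] := closed_field_poly_normal (char_poly H).
rewrite (monicP (char_poly_monic H)) scale1r in rE.
have [/allP r0|/allPn[a ar a0]] := boolP (all (pred1 0) r); last first.
  by exists a => //; rewrite eigenvalue_root_char rE root_prod_XsubC.
have : H ^+ (size r) = 0.
  have := Cayley_Hamilton H; rewrite rE big_seq.
  rewrite (eq_bigr (fun=> 'X)) => [|a /r0 /eqP ->]; last by rewrite subr0.
  by rewrite -big_seq big_const_seq count_predT iter_mulr_1 rmorphXn /= horner_mx_X.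
case: (size r) => [/eqP|k Hk]; first by rewrite oner_eq0.
have := @hermitian_exp_eq0 _ _ mul_conj_norm _ H 1 k aH; rewrite !mulr1 => /(_ Hk) H00.
by rewrite H00 eqxx in H0.
Qed.

Lemma symmetric_eigenR m (H : 'M[R]_m.+1) :
  adjoint idfun H = H -> H != 0 -> exists2 a, a != 0 & eigenvalue H a.
Proof.
move=> aH H0; pose f := real_complex R; pose HC := map_mx f H.
have aHC : adjoint Num.conj HC = HC.
  apply/matrixP=> i j; have /matrixP/(_ i j) := aH; rewrite !mxE /= => ->.
  by apply/CrealP/complex_realP; eexists.
have HC0 : HC != 0 by rewrite map_mx_eq0.
have [a a0 aE] := hermitian_eigenC aHC HC0.
have ca := hermitian_eigenvalue_conj mul_conj_norm aHC aE.
have fa : a = f (complex.Re a) by apply/esym/RRe_real/CrealP.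
exists (complex.Re a); last by rewrite fa /HC eigenvalue_map in aE.
by apply: contraNneq a0 => Re0; rewrite fa Re0 /f rmorph0.
Qed.

Variable Gamma : groupType.

Lemma unitary_equivalenceC d (rho sigma : Gamma -> 'M[C]_d) :
    unitary_rep Num.conj rho -> unitary_rep Num.conj sigma ->
    (forall g, \tr (rho g) = \tr (sigma g)) ->
  exists2 U, U \in unitmx & intertwines rho sigma U.
Proof.
move=> rU sU /(unitary_equivalence mul_conj_norm conj_sqrtC hermitian_eigenC rU sU).
by case=> U /mulmx1_unit[UU _] UI; exists U.
Qed.

Lemma orthogonal_equivalence d (rho sigma : Gamma -> 'M[R]_d) :
    (forall g h, rho (g * h)%g = rho g *m rho h) ->
    (forall g, rho g *m (rho g)^T = 1%:M) ->
    (forall g h, sigma (g * h)%g = sigma g *m sigma h) ->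
    (forall g, sigma g *m (sigma g)^T = 1%:M) ->
    (forall g, \tr (rho g) = \tr (sigma g)) ->
  exists2 U, U *m U^T = 1%:M & forall g, rho g *m U = U *m sigma g.
Proof.
have adjE (M : 'M[R]_d) : adjoint idfun M = M^T by rewrite /adjoint map_mx_id.
move=> rM rO sM sO trE.
have rU : unitary_rep idfun rho by split=> // g; rewrite adjE.
have sU : unitary_rep idfun sigma by split=> // g; rewrite adjE.
have := unitary_equivalence mul_id_norm id_sqrtR symmetric_eigenR rU sU trE.
by case=> U UU UI; exists U => //; rewrite -adjE.
Qed.

End RealComplex.

(** * Coefficients in the Clifford algebra *)

Section CliffordCoefficients.
Variables (n : nat) (R : comNzRingType).
Local Notation Cl := (clifford n R).
Implicit Types (x y : Cl) (v w : 'rV[R]_n) (I J K : {set 'I_n}).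

Lemma cl_signC I J :
  cl_sign R I J = (-1) ^+ (#|I| * #|J| + #|I :&: J|) * cl_sign R J I.
Proof.
rewrite /cl_sign -(inversionsC I J) -exprD -signr_odd -[RHS]signr_odd; congr (_ ^+ nat_of_bool _).
rewrite !oddD; by case: (odd _) (odd (inversions J I)) (odd #|_|) => [] [] [].
Qed.

Lemma cl_coef_mul_basis x I J :
  (x * cl_basis R I) J = cl_sign R (symd J I) I * x (symd J I).
Proof.
rewrite cl_mul_coef (bigD1 (symd J I)) //= big1 ?addr0 => [|K KJ].
  by rewrite -symdA [symd I J]symdC symdA symdd sym0d cl_basisE eqxx mulr1.
rewrite cl_basisE symd_eq; case: eqP => [JE|]; last by rewrite !mulr0.
by rewrite JE -symdA symdd symd0 eqxx in KJ.
Qed.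

Lemma cl_coef_basis_mul x I J :
  (cl_basis R I * x) J = cl_sign R I (symd I J) * x (symd I J).
Proof.
rewrite cl_mul_coef (bigD1 I) //= big1 ?addr0 => [|K /negPf KI].
  by rewrite cl_basisE eqxx mul1r.
by rewrite cl_basisE KI mul0r mulr0.
Qed.

(** The scalar coefficient is a trace on the Clifford algebra. *)
Lemma cl_coef0_mulC x y : (x * y) set0 = (y * x) set0.
Proof.
by rewrite !cl_mul_coef; apply: eq_bigr => I _; rewrite symd0 [y I * _]mulrC.
Qed.

(** The grade involution, the algebra automorphism equal to - 1 on vectors. *)
Definition cl_hat x : Cl := [ffun I : {set 'I_n} => (-1) ^+ #|I| * x I].

Lemma cl_hatE x I : cl_hat x I = (-1) ^+ #|I| * x I.
Proof. by rewrite ffunE. Qed.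

Lemma cl_hatM x y : cl_hat (x * y) = cl_hat x * cl_hat y.
Proof.
apply/ffunP=> K; rewrite cl_hatE !cl_mul_coef mulr_sumr; apply: eq_bigr => I _.
rewrite !cl_hatE -[(-1) ^+ #|K|]signr_odd.
have -> : odd #|K| = odd #|I| (+) odd #|symd I K| by rewrite odd_card_symd addbA addbb.
by rewrite signr_addb !signr_odd; ring.
Qed.

Lemma cl_hat_even x : cl_even x -> cl_hat x = x.
Proof.
move=> /forallP xE; apply/ffunP=> I; rewrite cl_hatE -signr_odd.
have /implyP := xE I; have [->|_ /(_ isT)/negPf->] := eqVneq (x I) 0.
  by rewrite mulr0.
by rewrite mul1r.
Qed.

Lemma cl_hat1 : cl_hat 1 = 1.
Proof. exact/cl_hat_even/cl_even1. Qed.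

Lemma cl_hat_vec v : cl_hat (cl_vec v) = - cl_vec v.
Proof.
apply/ffunP=> I; rewrite cl_hatE; have /forallP/(_ I)/implyP := cl_vec_is_vec v.
rewrite [RHS]ffunE; have [->|_ /(_ isT)/eqP->] := eqVneq (cl_vec v I) 0.
  by rewrite mulr0 oppr0.
by rewrite mulN1r.
Qed.

Lemma cl_basis_induction (P : Cl -> Prop) :
    P 1 -> (forall i x, P x -> P (cl_basis R [set i] * x)) ->
    (forall a x y, P x -> P y -> P (a *: x + y)) -> forall x, P x.
Proof.
move=> P1 PM PD.
have P0 : P 0 by rewrite -(subrr 1) addrC -scaleN1r; apply: PD.
have PZ a x : P x -> P (a *: x) by rewrite -[a *: x]addr0 => Px; apply: PD.
have PB k I : #|I| = k -> P (cl_basis R I).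
  elim: k I => [|k IHk] I Ik; first by rewrite (cards0_eq Ik).
  have /card_gt0P[i iI] : (0 < #|I|)%N by rewrite Ik.
  have Ii : #|I :\ i| = k by move: Ik; rewrite (cardsD1 i) iI => -[].
  have := PZ (cl_sign R [set i] (I :\ i)) _ (PM i _ (IHk _ Ii)).
  rewrite cl_basisM scalerA -cl_signDr symdd cl_sign0r scale1r.
  congr (P (cl_basis R _)); apply/setP=> j; rewrite in_symd !inE.
  by case: (eqVneq j i) => [->|]; rewrite ?iI.
move=> x; rewrite (cl_expand x).
by elim/big_rec: _ => // I y _ Py; apply: PD => //; apply: PB.
Qed.

Lemma cl_rev_basis I : cl_rev (cl_basis R I) = (-1) ^+ 'C(#|I|, 2) *: cl_basis R I.
Proof.
apply/ffunP=> J; rewrite cl_revE cl_scaleE cl_basisE.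
by case: eqP => [->|]; rewrite ?mulr0.
Qed.

Lemma cl_rev_vec v : cl_rev (cl_vec v) = cl_vec v.
Proof.
apply/ffunP=> I; rewrite cl_revE; have /forallP/(_ I)/implyP := cl_vec_is_vec v.
have [->|_ /(_ isT)/eqP->] := eqVneq (cl_vec v I) 0; first by rewrite mulr0.
by rewrite mul1r.
Qed.

(** The sign of e_I e_I and the sign of the reversal of e_I are both
    (-1)^(m (m - 1) / 2) with m = #|I|. *)
Lemma cl_basis_rev I : cl_basis R I * cl_rev (cl_basis R I) = 1.
Proof.
rewrite cl_rev_basis -scalerAr cl_basisM symdd scalerA cl_basis0.
suff -> : 'C(#|I|, 2) = inversions I I by rewrite -exprD addnn -signr_odd odd_double scale1r.
have := inversionsC I I; rewrite setIid.
have : ('C(#|I|, 2).*2 + #|I| = #|I| * #|I|)%N.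
  by elim: #|I| => // m IHm; rewrite binS bin1; nia.
by lia.
Qed.

Definition cl_vol : Cl := cl_basis R setT.

(** The volume element commutes with e_I up to the sign (-1)^(#|I| (n + 1)). *)
Lemma cl_vol_central x : odd n -> cl_vol * x = x * cl_vol.
Proof.
move=> n_odd; apply/ffunP=> J; rewrite cl_coef_mul_basis cl_coef_basis_mul symdC.
rewrite [cl_sign R (symd J _) _]cl_signC setIT cardsT card_ord -signr_odd oddD oddM n_odd.
by rewrite andbT addbb mul1r.
Qed.

End CliffordCoefficients.

(** * Scalar coefficients and the kernel of the covering *)

Section ScalarPart.
Variables (n : nat) (F : fieldType).
Local Notation Cl := (clifford n F).
Implicit Types (x y h : Cl) (v : 'rV[F]_n) (I J : {set 'I_n}).

Lemma cl_coef_mul_vec x v J :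
  (x * cl_vec v) J =
  \sum_i v 0 i * (cl_sign F (symd J [set i]) [set i] * x (symd J [set i])).
Proof.
rewrite /cl_vec mulr_sumr cl_sumE; apply: eq_bigr => i _.
by rewrite -scalerAr cl_scaleE cl_coef_mul_basis.
Qed.

Lemma cl_coef_vec_mul x v J :
  (cl_vec v * x) J =
  \sum_i v 0 i * (cl_sign F [set i] (symd J [set i]) * x (symd J [set i])).
Proof.
rewrite /cl_vec mulr_suml cl_sumE; apply: eq_bigr => i _.
by rewrite -scalerAl cl_scaleE cl_coef_basis_mul symdC.
Qed.

(** Let h_p be the component of h of lowest degree p. The component of degree
    p - 1 of h v is (-1)^(p - 1) times the contraction of h_p with v, and that
    of (v A) hat h is (-1)^p times the contraction of h_p with v A. So the
    contraction of h_p with v + v A, that is, with any vector, is 0, whence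
    p = 0. *)
Lemma cl_scalar_part_neq0 h (A : 'M[F]_n) : h != 0 ->
    (forall v, h * cl_vec v = cl_vec (v *m A) * cl_hat h) ->
    1%:M + A \in unitmx -> h set0 != 0.
Proof.
move=> h0 hA uA; apply: contraNneq h0 => h00; apply/eqP; apply: contrapT => hn0.
have [I0 hI0] : exists I, h I != 0.
  apply: contrapT => noI; apply: hn0; apply/ffunP=> I; rewrite [RHS]ffunE.
  by apply/eqP; apply: contrapT => /negP hI; apply: noI; exists I.
have [K hK Kmin] := @arg_minnP _ I0 (fun I => h I != 0) (fun I => #|I|) hI0.
have /card_gt0P[k kK] : (0 < #|K|)%N.
  by rewrite card_gt0; apply: contraNneq hK => ->; rewrite h00.
pose J := K :\ k; have JK : #|K| = #|J|.+1 by rewrite (cardsD1 k K) kK.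
(* With v + v A = e_k, the coefficient of e_J in h v - (v A) hat h is, up to
   sign, the coefficient of e_K in h. *)
pose v := delta_mx 0 k *m invmx (1%:M + A) : 'rV[F]_n.
have vE : v + v *m A = delta_mx 0 k by rewrite -[v in v + _]mulmx1 -mulmxDr mulmxKV.
have /ffunP/(_ J) := hA v; rewrite cl_coef_mul_vec cl_coef_vec_mul.
move/eqP; rewrite -subr_eq0 -sumrB.
rewrite (eq_bigr (fun i => (v + v *m A) 0 i *
    ((-1) ^+ #|K|.+1 * cl_sign F [set i] (symd J [set i]) * h (symd J [set i])))).
  rewrite vE (bigD1 k) //= big1 ?addr0 => [|i ik]; last by rewrite mxE (negPf ik) andbF mul0r.
  have -> : symd J [set k] = K.
    by apply/setP=> i; rewrite in_symd !inE; case: eqVneq => [->|] //=; rewrite ?kK ?addbF.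
  by rewrite mxE !eqxx mul1r /cl_sign -exprD mulf_eq0 signr_eq0 (negPf hK).
move=> i _; rewrite [(v + _) 0 i]mxE cl_hatE.
set S := symd J _; have [->|hS] := eqVneq (h S) 0; first by rewrite !mulr0 subrr.
have iJ : i \notin J.
  apply/negP=> iJ; have := Kmin S hS; rewrite JK.
  have := card_symd J [set i]; rewrite -/S cards1.
  have -> : J :&: [set i] = [set i] by apply/setIidPr; rewrite sub1set.
  by rewrite cards1; lia.
have SE : #|S| = #|K|.
  have := card_symd J [set i]; rewrite -/S cards1 JK.
  have -> : J :&: [set i] = set0 by apply/eqP; rewrite setI_eq0 disjoint_sym disjoints1.
  by rewrite cards0; lia.
have iS : S :&: [set i] = [set i].
  by apply/setIidPr; rewrite sub1set in_symd set11 (negPf iJ).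
rewrite [cl_sign _ S _]cl_signC iS SE cards1 muln1 addn1 exprS; ring.
Qed.

End ScalarPart.

Section SpinCenter.
Variables (n : nat) (R : realType).
Local Notation Cl := (clifford n R).
Implicit Types (x y z : Cl) (v w u : 'rV[R]_n) (I J : {set 'I_n}).

(** If i belongs to I and #|I| is even, then e_i anticommutes with e_I. *)
Lemma cl_even_central z : cl_even z ->
  (forall i, z * cl_basis R [set i] = cl_basis R [set i] * z) -> z = (z set0)%:A.
Proof.
move=> /forallP zE zC; apply/ffunP=> I; rewrite cl_scaleE cl_basisE.
have [->|I0] := eqVneq I set0; rewrite ?mulr1 ?mulr0 //.
have /set0Pn[i iI] := I0.
have /ffunP/(_ (I :\ i)) := zC i; rewrite cl_coef_mul_basis cl_coef_basis_mul.
have -> : symd [set i] (I :\ i) = I.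
  by apply/setP=> j; rewrite in_symd !inE; case: eqVneq => [->|]; rewrite ?iI.
have -> : symd (I :\ i) [set i] = I.
  by apply/setP=> j; rewrite in_symd !inE; case: eqVneq => [->|] //=; rewrite ?iI ?addbF.
have [->//|zI] := eqVneq (z I) 0.
have /implyP/(_ zI) eI := zE I.
rewrite [cl_sign R I _]cl_signC; have -> : I :&: [set i] = [set i].
  by apply/setIidPr; rewrite sub1set.
rewrite cards1 muln1 -signr_odd oddD (negPf eI) expr1 mulN1r mulNr.
move/eqP; rewrite eq_sym -addr_eq0 -mulr2n mulrn_eq0 /= mulf_eq0.
by rewrite signr_eq0 => /eqP.
Qed.

(** The quotient y^-1 x is even and commutes with all vectors, so it is a scalar
    of square 1. *)
Lemma spin_mx_eq x y : is_spin x -> is_spin y -> spin_mx x = spin_mx y ->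
  x = y \/ x = - y.
Proof.
move=> xS yS xy; have [yE y1 y1' _] := is_spinP _ yS.
have [xE x1 x1' _] := is_spinP _ xS.
pose z := cl_rev y * x; have zS : is_spin z by rewrite is_spinM ?is_spin_rev.
have [zE z1 z1' _] := is_spinP _ zS.
have z_mx : spin_mx z = 1%:M.
  rewrite spin_mxM ?is_spin_rev // xy -spin_mxM ?is_spin_rev // y1'.
  exact: spin_mx1.
have zC i : z * cl_basis R [set i] = cl_basis R [set i] * z.
  have := spin_mxE (delta_mx 0 i) zS; rewrite z_mx trmx1 mulmx1 cl_vec_delta.
  by move/(congr1 ( *%R^~ z)); rewrite -!mulrA z1' mulr1.
have zc := cl_even_central zE zC; set c := z set0 in zc.
have xE' : x = c *: y.
  by rewrite -[x]mul1r -y1 -mulrA -/z zc -scalerAr mulr1.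
have : c ^+ 2 = 1.
  move: z1; rewrite zc => /ffunP/(_ set0).
  rewrite -scalerAl mul1r !cl_scaleE cl_revE cards0 mul1r cl_scaleE.
  by rewrite !cl_basisE eqxx mulr1.
by move/eqP; rewrite sqrf_eq1 xE' => /orP[] /eqP->; [left|right];
  rewrite ?scale1r ?scaleN1r.
Qed.

End SpinCenter.

Section SpinSigns.
Variables (n : nat) (R : realType).
Local Notation Cl := (clifford n R).
Implicit Types (x y : Cl) (v w : 'rV[R]_n) (e : int).

Lemma is_spin_sign x e : e = 1 \/ e = -1 -> is_spin x -> is_spin (e%:~R *: x).
Proof.
move=> e1 xS; have [xE xx x'x xV] := is_spinP _ xS.
have revZ : cl_rev (e%:~R *: x) = e%:~R *: cl_rev x.
  by apply/ffunP=> I; rewrite cl_revE !cl_scaleE cl_revE mulrCA.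
have ee : e%:~R * e%:~R = 1 :> R by case: e1 => ->; rewrite ?mulr1 ?mulrNN ?mulr1.
apply/is_spinP; rewrite revZ; split.
- apply/forallP=> I; apply/implyP; rewrite cl_scaleE mulf_eq0 negb_or.
  by case/andP=> _; apply/implyP; have /forallP := xE.
- by rewrite -scalerAl -scalerAr scalerA ee scale1r.
- by rewrite -scalerAl -scalerAr scalerA ee scale1r.
move=> v; have [w vw] := xV v; exists w.
by rewrite -!scalerAl -scalerAr scalerA ee scale1r.
Qed.

Lemma spin_mx_sign x e : e = 1 \/ e = -1 -> spin_mx (e%:~R *: x) = spin_mx x.
Proof.
move=> e1; apply/matrixP=> i j; rewrite !mxE.
have revZ : cl_rev (e%:~R *: x) = e%:~R *: cl_rev x.
  by apply/ffunP=> I; rewrite cl_revE !cl_scaleE cl_revE mulrCA.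
have ee : e%:~R * e%:~R = 1 :> R by case: e1 => ->; rewrite ?mulr1 ?mulrNN ?mulr1.
by rewrite revZ -!scalerAl -scalerAr scalerA ee scale1r.
Qed.

Lemma spin_mx_rev x : is_spin x -> spin_mx (cl_rev x) = (spin_mx x)^T.
Proof.
move=> xS; have [_ xx x'x _] := is_spinP _ xS.
rewrite -[LHS]mulmx1 -(spin_mx_orthogonalC xS) mulmxA -spin_mxM ?is_spin_rev //.
by rewrite x'x spin_mx1 mul1mx.
Qed.

Lemma spin_sign_unique x (a b : R) : is_spin x -> a *: x = b *: x -> a = b.
Proof.
move=> xS /(congr1 ( *%R^~ (cl_rev x))); have [_ xx _ _] := is_spinP _ xS.
rewrite -!scalerAl xx => /ffunP/(_ set0).
by rewrite !cl_scaleE cl_basisE eqxx !mulr1.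
Qed.

Lemma spin_conj_sign x y (e : int) : is_spin x -> is_spin y -> e = 1 \/ e = -1 ->
  x * y * cl_rev x = e%:~R *: y -> cl_rev y * (x * y) = e%:~R *: x.
Proof.
move=> xS yS e1 xy; have [_ xx x'x _] := is_spinP _ xS.
have [_ _ y'y _] := is_spinP _ yS.
have -> : x * y = e%:~R *: y * x by rewrite -xy -[RHS]mulrA x'x mulr1.
by rewrite -scalerAl -scalerAr mulrA y'y mul1r.
Qed.

Lemma spin_conj_coef0 x y : is_spin x -> (x * y * cl_rev x) set0 = y set0.
Proof.
move=> xS; have [_ _ x'x _] := is_spinP _ xS.
by rewrite -mulrA cl_coef0_mulC -mulrA x'x mulr1.
Qed.

End SpinSigns.

(** * Reflections *)

Section Reflections.
Variable R : realType.

Definition refl n (u : 'rV[R]_n) : 'M[R]_n := 1%:M - 2 *: (u^T *m u).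

Lemma mul_refl m n (B : 'M_(m, n)) (u : 'rV_n) :
  B *m refl u = B - 2 *: (B *m u^T *m u).
Proof. by rewrite mulmxBr mulmx1 -scalemxAr mulmxA. Qed.

Lemma tr_refl n (u : 'rV_n) : (refl u)^T = refl u.
Proof. by rewrite linearB linearZ /= trmx1 trmx_mul trmxK. Qed.

Lemma refl_invol n (u : 'rV_n) : u *m u^T = 1%:M -> refl u *m refl u = 1%:M.
Proof.
move=> uu; rewrite mul_refl; have -> : refl u *m u^T = - u^T.
  rewrite mulmxBl mul1mx -scalemxAl -mulmxA uu mulmx1.
  by rewrite scaler_nat mulr2n opprD addrA subrr sub0r.
by rewrite mulNmx scalerN opprK subrK.
Qed.

Lemma refl_orthogonal n (u : 'rV_n) : u *m u^T = 1%:M -> refl u *m (refl u)^T = 1%:M.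
Proof. by move=> uu; rewrite tr_refl refl_invol. Qed.

(** Expand the determinant of a bordered matrix in two ways, as in the identity
    det (1 - a b) = det (1 - b a). *)
Lemma det_refl n (u : 'rV_n) : u *m u^T = 1%:M -> \det (refl u) = -1.
Proof.
move=> uu.
have <- : \det (block_mx 1%:M u (2 *: u^T) 1%:M : 'M_(1 + n)) = \det (refl u).
  have -> : block_mx 1%:M u (2 *: u^T) 1%:M =
    block_mx 1%:M 0 (2 *: u^T) 1%:M *m block_mx 1%:M u 0 (refl u) :> 'M_(1 + n).
    rewrite mulmx_block !(mul1mx, mulmx1, mul0mx, mulmx0, addr0, add0r).
    by rewrite /refl -scalemxAl addrC subrK.
  by rewrite det_mulmx det_lblock det_ublock !det1 !mul1r.
have -> : block_mx 1%:M u (2 *: u^T) 1%:M =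
    block_mx 1%:M u 0 1%:M *m block_mx (- 1)%:M 0 (2 *: u^T) 1%:M :> 'M_(1 + n).
  rewrite mulmx_block !(mul1mx, mulmx1, mul0mx, mulmx0, addr0, add0r).
  rewrite -scalemxAr uu; congr (block_mx _ _ _ _).
  by apply/matrixP=> i j; rewrite !mxE; case: (i == j); rewrite /= ?mulr0 ?addr0 //; ring.
by rewrite det_mulmx det_lblock det_ublock !det1 !mul1r mulr1 det_scalar1.
Qed.

Lemma unit_multiple n (d : 'rV[R]_n) : d != 0 ->
  exists2 u, u *m u^T = 1%:M & exists2 c, c != 0 & d = c *: u.
Proof.
move=> d0; pose s := (d *m d^T) 0 0.
have sE : s = \sum_i d 0 i ^+ 2.
  by rewrite /s mxE; apply: eq_bigr => i _; rewrite mxE expr2.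
have s0 : 0 < s.
  rewrite lt0r sE sumr_ge0 ?andbT => [|i _]; last exact: sqr_ge0.
  apply: contraNneq d0 => /eqP; rewrite psumr_eq0 => [/allP dd|i _]; last exact: sqr_ge0.
  apply/eqP/rowP=> i; have := dd i; rewrite mem_index_enum => /(_ isT).
  by rewrite /= sqrf_eq0 mxE => /eqP.
have r0 : Num.sqrt s != 0 by rewrite gt_eqF ?sqrtr_gt0.
exists ((Num.sqrt s)^-1 *: d); last first.
  by exists (Num.sqrt s) => //; rewrite scalerA divff ?scale1r.
rewrite linearZ -scalemxAl -scalemxAr scalerA [d *m _]mx11_scalar -/s.
rewrite scale_scalar_mx -invfM -expr2 sqr_sqrtr ?ltW // mulVf ?gt_eqF //.
Qed.

(** The orthogonal group is generated by reflections: if B fixes the first basis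
    vectors and sends the next one e to a <> e, the reflection that exchanges a
    and e fixes the same vectors, and B followed by it also fixes e. *)
Lemma orthogonal_ind n (P : 'M[R]_n -> Prop) :
    P 1%:M -> (forall u A, u *m u^T = 1%:M -> P A -> P (A *m refl u)) ->
  forall A, A *m A^T = 1%:M -> P A.
Proof.
move=> P1 Prefl A AA.
suff H k (B : 'M_n) : (k <= n)%N -> B *m B^T = 1%:M ->
    (forall i : 'I_n, (i < n - k)%N -> row i B = delta_mx 0 i) -> P B.
  by apply: (H n) => // i; rewrite subnn.
elim: k B => [|k IHk] B kn BB Bfix.
  suff -> : B = 1%:M by [].
  by apply/row_matrixP=> i; rewrite Bfix ?subn0 // rowE mulmx1.
have lt_n : (n - k.+1 < n)%N by lia.
pose j := Ordinal lt_n; pose e : 'rV[R]_n := delta_mx 0 j; pose a := row j B.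
have rowBB i l : row i B *m (row l B)^T = (i == l)%:R%:M.
  apply/matrixP=> x y; rewrite !ord1 !mxE eqxx mulr1n.
  by have /matrixP/(_ i l) := BB; rewrite !mxE => <-; apply: eq_bigr => x' _; rewrite !mxE.
have [ae|ae] := eqVneq a e.
  apply: IHk => // [|i]; first exact: ltnW.
  rewrite (_ : n - k = (n - k.+1).+1)%N; last by lia.
  rewrite ltnS leq_eqVlt => /orP[/eqP ij|]; last exact: Bfix.
  by have -> : i = j by apply: val_inj.
have [u uu [c c0 aeE]] : exists2 u, u *m u^T = 1%:M & exists2 c, c != 0 & a - e = c *: u.
  by apply: unit_multiple; rewrite subr_eq0.
pose B' := B *m refl u; have -> : B = B' *m refl u by rewrite -mulmxA refl_invol ?mulmx1.
apply: Prefl => //; apply: IHk; first exact: ltnW.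
  by rewrite trmx_mul mulmxA -[B *m _ *m _]mulmxA refl_orthogonal ?mulmx1.
have aa : a *m a^T = 1%:M by rewrite rowBB eqxx.
have ee : e *m e^T = 1%:M by rewrite trmx_delta mul_delta_mx; apply/matrixP=> x y; rewrite !ord1 !mxE.
move=> i; rewrite (_ : n - k = (n - k.+1).+1)%N; last by lia.
rewrite ltnS leq_eqVlt row_mul mul_refl => /orP[/eqP ij|ij].
  have {i ij} -> : i = j by apply: val_inj.
  (* a reflection in a - e exchanges the unit vectors a and e *)
  rewrite -/a -/e; suff au : a *m u^T = (c / 2)%:M.
    rewrite au mul_scalar_mx scalerA mulrCA divff ?pnatr_eq0 // mulr1 -aeE.
    by rewrite opprB addrC subrK.
  have [t aet] : exists t, a *m e^T = t%:M by exists ((a *m e^T) 0 0); apply: mx11_scalar.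
  have eat : e *m a^T = t%:M by rewrite -[LHS]trmxK trmx_mul trmxK aet tr_scalar_mx.
  have au : c *: (a *m u^T) = (1 - t)%:M.
    by rewrite scalemxAr -linearZ -aeE linearB /= mulmxBr aa aet raddfB.
  have cc : (c ^+ 2)%:M = (2 * (1 - t))%:M :> 'M_1.
    rewrite -[LHS]mulmx1 -uu mul_scalar_mx expr2 -scalerA scalemxAl scalemxAr -linearZ -aeE.
    rewrite linearB /= mulmxBl !mulmxBr aa aet eat ee -!raddfB /=; congr (_%:M); ring.
  apply: (scalerI c0); rewrite au scale_scalar_mx; congr (_%:M).
  have := congr1 (fun M : 'M_1 => M 0 0) cc; rewrite !mxE !mulr1n => cc'.
  by rewrite mulrA -expr2 cc' mulrC mulKf ?pnatr_eq0.
rewrite Bfix //; suff -> : delta_mx 0 i *m u^T = 0 :> 'M_1 by rewrite mul0mx scaler0 subr0.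
apply: (scalerI c0); rewrite scaler0 scalemxAr -linearZ /= -aeE.
have ij' : (i == j) = false by rewrite -val_eqE /= ltn_eqF.
rewrite linearB /= mulmxBr -(Bfix _ ij) rowBB ij' Bfix // trmx_delta mul_delta_mx_cond ij'.
by rewrite mulr0n subr0 raddf0.
Qed.

End Reflections.

(** * Volume elements of subspaces and half-turns *)

Section Frames.
Variables (n : nat) (R : realType).
Local Notation Cl := (clifford n R).
Implicit Types (x y z : Cl) (u v w : 'rV[R]_n).

Lemma orthonormal_basis m (V : 'M[R]_(m, n)) :
  exists p (B : 'M_(p, n)), B *m B^T = 1%:M /\ (B :=: V)%MS.
Proof.
elim: m V => [|m IHm] V.
  by exists 0%N, V; split=> //; apply/matrixP; case.
suff H (v : 'rV[R]_n) (V' : 'M[R]_(m, n)) : exists p (B : 'M[R]_(p, n)),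
    B *m B^T = 1%:M /\ (B :=: col_mx v V')%MS.
  by have := H (usubmx (V : 'M_(1 + m, n))) (dsubmx (V : 'M_(1 + m, n))); rewrite vsubmxK.
have [p [B [BB BV]]] := IHm V'.
have VB : (V' <= B)%MS by rewrite BV.
pose d := v - v *m B^T *m B.
have dB : d *m B^T = 0 by rewrite mulmxBl -[_ *m B *m B^T]mulmxA BB mulmx1 subrr.
have vE : v = d + v *m B^T *m B by rewrite subrK.
have [d0|/unit_multiple[u uu [c c0 dE]]] := eqVneq d 0.
  exists p, B; split=> //; apply/eqmxP; rewrite col_mx_sub -!addsmxE vE d0 add0r.
  by rewrite submxMl VB BV addsmxSr.
exists (1 + p)%N, (col_mx u B); split.
  have uB : u *m B^T = 0 by apply: (scalerI c0); rewrite scaler0 scalemxAl -dE dB.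
  have Bu : B *m u^T = 0 by rewrite -[LHS]trmxK trmx_mul trmxK uB trmx0.
  by rewrite tr_col_mx mul_col_row uu BB uB Bu -scalar_mx_block.
have uE : u = c^-1 *: (v - v *m B^T *m B) by rewrite -/d dE scalerK.
apply/eqmxP; rewrite -!addsmxE !addsmx_sub (submx_trans VB (addsmxSr _ _)) andbT.
have BV' : (B <= V')%MS by rewrite BV.
rewrite (submx_trans BV' (addsmxSr _ _)) andbT.
apply/andP; split.
  rewrite uE scalemx_sub // addmx_sub ?addsmxSl // eqmx_opp.
  by apply: submx_trans (addsmxSr _ _); apply: submx_trans BV'; apply: submxMl.
rewrite [v in (v <= _)%MS]vE addmx_sub //.
  by apply: submx_trans (addsmxSl _ _); rewrite dE scalemx_sub.
by apply: submx_trans (addsmxSr _ _); apply: submxMl.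
Qed.

Lemma cl_vec_swap u v : cl_vec u * cl_vec v = (2 * (u *m v^T) 0 0)%:A - cl_vec v * cl_vec u.
Proof. by rewrite mulr_natl -cl_vecM addrK. Qed.

Lemma cl_vec_unit u : u *m u^T = 1%:M -> cl_vec u * cl_vec u = 1.
Proof.
move=> uu; apply: (@scalerI R _ 2); first by rewrite pnatr_eq0.
by rewrite scaler_nat mulr2n cl_vecM uu mxE eqxx.
Qed.

Lemma cl_vec_refl u v : u *m u^T = 1%:M ->
  cl_vec u * cl_vec v * cl_vec u = - cl_vec (v *m refl u).
Proof.
move=> uu; rewrite cl_vec_swap mulrBl -mulrA cl_vec_unit // mulr1 -scalerAl mul1r.
rewrite mul_refl linearB opprB /=; congr (_ - _).
have vu : v *m u^T = ((u *m v^T) 0 0)%:M.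
  by rewrite [LHS]mx11_scalar -[v *m u^T]trmxK trmx_mul trmxK mxE.
by rewrite vu mul_scalar_mx scalerA linearZ.
Qed.

(** When the rows of B form an orthonormal basis of a subspace, this is the
    volume element of the subspace. *)
Definition frame_prod p (B : 'M[R]_(p, n)) : Cl := \prod_(i < p) cl_vec (row i B).

Lemma prod_commute_sign p (g : 'I_p -> Cl) z (c : 'I_p -> nat) :
    (forall i, g i * z = (-1) ^+ c i * (z * g i)) ->
  (\prod_i g i) * z = (-1) ^+ (\sum_i c i) * (z * \prod_i g i).
Proof.
move=> gz; elim: p g c gz => [|p IHp] g c gz.
  by rewrite !big_ord0 expr0 !mul1r mulr1.
rewrite !big_ord_recl /= -mulrA (IHp _ (fun i => c (lift ord0 i)) (fun i => gz _)).
rewrite [LHS]mulrA commr_sign -[LHS]mulrA [X in _ * X = _]mulrA gz exprD -!mulrA.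
by rewrite [LHS]mulrA [RHS]mulrA commr_sign.
Qed.

Lemma cl_hat_frame p (B : 'M_(p, n)) : cl_hat (frame_prod B) = (-1) ^+ p * frame_prod B.
Proof.
rewrite /frame_prod.
rewrite -[p in (-1) ^+ p](card_ord p) -sum1_card.
elim/big_rec2: _ => [|i x m _ E]; first by rewrite mulr1 cl_hat1.
by rewrite cl_hatM cl_hat_vec E exprS mulN1r !mulNr mulrA commr_sign -mulrA.
Qed.

Section Orthonormal.
Variables (p : nat) (B : 'M[R]_(p, n)).
Hypothesis BB : B *m B^T = 1%:M.

Lemma row_frame i j : (row i B *m (row j B)^T) 0 0 = (i == j)%:R.
Proof.
have /matrixP/(_ i j) := BB; rewrite !mxE => <-.
by apply: eq_bigr => k _; rewrite !mxE.
Qed.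

Lemma row_frame_unit i : row i B *m (row i B)^T = 1%:M.
Proof. by rewrite [LHS]mx11_scalar row_frame eqxx. Qed.

Lemma frame_mul_perp v : v *m B^T = 0 ->
  frame_prod B * cl_vec v = cl_vec v * cl_hat (frame_prod B).
Proof.
move=> vB; rewrite /frame_prod (@prod_commute_sign _ _ _ (fun=> 1%N)) => [|i].
  by rewrite sum1_card card_ord cl_hat_frame [RHS]mulrA commr_sign -mulrA.
rewrite expr1 mulN1r cl_vec_swap (_ : row i B *m v^T = 0) ?mxE ?mulr0 ?scale0r ?sub0r //.
by rewrite -row_mul -[B *m _]trmxK trmx_mul trmxK vB trmx0 row0.
Qed.

(** A vector b_j of the frame commutes with itself and anticommutes with the
    p - 1 other ones. *)
Lemma frame_mul_in (a : 'rV_p) :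
  frame_prod B * cl_vec (a *m B) = - (cl_vec (a *m B) * cl_hat (frame_prod B)).
Proof.
rewrite mulmx_sum_row linear_sum /= mulr_sumr mulr_suml -sumrN; apply: eq_bigr => j _.
rewrite linearZ /= -scalerAr -scalerAl -scalerN; congr (_ *: _).
rewrite /frame_prod (@prod_commute_sign _ _ _ (fun i => (i != j) : nat)) => [|i].
  have -> : (\sum_i (i != j))%N = p.-1.
    by rewrite -big_mkcond sum1_card cardC1 card_ord.
  have p0 : (0 < p)%N := leq_ltn_trans (leq0n j) (ltn_ord j).
  have sE : (-1) ^+ p = - (-1) ^+ p.-1 :> Cl by rewrite -{1}(prednK p0) exprS mulN1r.
  rewrite cl_hat_frame sE [X in _ = - X]mulrA mulrN mulNr opprK commr_sign.
  by rewrite -[RHS]mulrA.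
have [->|ij] := eqVneq i j; first by rewrite mul1r.
by rewrite cl_vec_swap row_frame (negPf ij) mulr0 scale0r sub0r mulN1r.
Qed.

Lemma frame_prod_rev : cl_rev (frame_prod B) * frame_prod B = 1.
Proof.
rewrite /frame_prod; elim/big_rec: _ => [|i x _ xx]; first by rewrite cl_rev1 mulr1.
rewrite cl_revM cl_rev_vec mulrA -[_ * cl_vec _ * cl_vec _]mulrA.
by rewrite cl_vec_unit ?row_frame_unit // mulr1.
Qed.

(** Let w = u B. The row i of the reflected frame is - w b_i w, so the product
    of the rows telescopes to w (hat y) w, where y is the volume element; and w
    belongs to the span of the frame, so that [frame_mul_in] gives - y. *)
Lemma frame_prod_refl (u : 'rV_p) : u *m u^T = 1%:M ->
  frame_prod (refl u *m B) = - frame_prod B.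
Proof.
move=> uu; pose w := u *m B; have ww : w *m w^T = 1%:M.
  by rewrite trmx_mul mulmxA -[u *m _ *m _]mulmxA BB mulmx1.
have row_reflE i : cl_vec (row i (refl u *m B)) = - (cl_vec w * cl_vec (row i B) * cl_vec w).
  rewrite cl_vec_refl // opprK; congr cl_vec.
  rewrite mul_refl mulmxBl mul1mx linearB /=; congr (_ - _).
  rewrite -scalemxAl linearZ /=; congr (_ *: _).
  rewrite !row_mul -[LHS]mulmxA -/w; congr (_ *m _).
  rewrite trmx_mul mulmxA -row_mul BB row1.
  by rewrite -rowE.
have wfw : cl_vec w * cl_vec w = 1 by apply: cl_vec_unit.
rewrite /frame_prod (eq_bigr _ (fun i _ => row_reflE i)).
have -> : \prod_i (- (cl_vec w * cl_vec (row i B) * cl_vec w)) =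
    cl_vec w * cl_hat (frame_prod B) * cl_vec w.
  rewrite cl_hat_frame /frame_prod -[p in (-1) ^+ p](card_ord p) -sum1_card.
  elim/big_rec3: _ => [|i m y x _ E]; first by rewrite !mulr1 wfw.
  rewrite E exprS mulN1r !mulNr mulrN mulNr; congr (- _).
  rewrite !mulrA -[_ * cl_vec w * cl_vec w]mulrA wfw mulr1; congr (_ * _ * _).
  by rewrite -!mulrA commr_sign.
by rewrite -[cl_vec w * _]opprK -frame_mul_in mulNr -mulrA wfw mulr1.
Qed.

End Orthonormal.

(** Conjugation by the volume element of V is, up to the grade involution, the
    map that is -1 on V and 1 on its orthogonal complement. *)
Lemma frame_mul_vec p (B : 'M[R]_(p, n)) v : B *m B^T = 1%:M ->
  frame_prod B * cl_vec v =
  cl_vec (v *m (1%:M - 2 *: (B^T *m B))) * cl_hat (frame_prod B).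
Proof.
move=> BB; pose w := v - v *m B^T *m B.
have wB : w *m B^T = 0 by rewrite mulmxBl -[_ *m B *m B^T]mulmxA BB mulmx1 subrr.
have vE : v = w + v *m B^T *m B by rewrite subrK.
have -> : v *m (1%:M - 2 *: (B^T *m B)) = w - v *m B^T *m B.
  rewrite mulmxBr mulmx1 -scalemxAr mulmxA scaler_nat mulr2n opprD addrA.
  by [].
clearbody w; rewrite {1}vE linearD linearB /= mulrDr mulrBl.
by rewrite (frame_mul_perp wB) (frame_mul_in BB).
Qed.

(** Both sides are multiplicative in M and change sign under a reflection. *)
Lemma frame_prod_det p (B : 'M[R]_(p, n)) (M : 'M_p) :
  B *m B^T = 1%:M -> M *m M^T = 1%:M ->
  frame_prod (M *m B) = \det M *: frame_prod B.
Proof.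
move=> BB MM; move: M MM B BB; apply: orthogonal_ind => [|u A uu IHA] B BB.
  by rewrite det1 scale1r mul1mx.
rewrite -mulmxA IHA; last first.
  by rewrite trmx_mul mulmxA -[_ *m B *m _]mulmxA BB mulmx1 refl_orthogonal.
by rewrite frame_prod_refl // det_mulmx det_refl // mulrN1 scaleNr scalerN.
Qed.

Lemma spin_conj_frame x p (B : 'M[R]_(p, n)) : is_spin x ->
  x * frame_prod B * cl_rev x = frame_prod (B *m (spin_mx x)^T).
Proof.
move=> xS; have [_ xx x'x _] := is_spinP _ xS; rewrite /frame_prod.
under [RHS]eq_bigr => i _ do rewrite row_mul -spin_mxE //.
elim/big_rec2: _ => [|i y z _ <-]; first by rewrite mulr1.
by rewrite !mulrA -[_ * cl_rev x * x]mulrA x'x mulr1.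
Qed.

(** If A is the matrix of x, then B A^T = M B for an orthogonal matrix M that is
    similar to the restriction of x to V, and [frame_prod_det] applies. *)
Lemma spin_conj_stable_frame x (V : 'M[R]_n) p (B : 'M[R]_(p, n)) :
    is_spin x -> stablemx V (spin_mx x)^T -> B *m B^T = 1%:M -> (B :=: V)%MS ->
  x * frame_prod B * cl_rev x =
  \det (restrictmx V (spin_mx x)^T) *: frame_prod B.
Proof.
move=> xS Vx BB BV; rewrite spin_conj_frame //; set A := (spin_mx x)^T in Vx *.
have AA : A *m A^T = 1%:M by rewrite trmxK spin_mx_orthogonal.
have BAE : B *m A = B *m A *m B^T *m B.
  have /submxP[D ->] : (B *m A <= B)%MS.
    by rewrite BV; apply: submx_trans Vx; apply: submxMr; rewrite BV.
  by rewrite -[D *m B *m _]mulmxA BB mulmx1.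
set M := B *m A *m B^T in BAE.
have MM : M *m M^T = 1%:M.
  by rewrite /M !trmx_mul trmxK !mulmxA -/M -BAE -[_ *m A *m A^T]mulmxA AA mulmx1.
rewrite [in LHS]BAE frame_prod_det //; congr (_ *: _).
have pE : p = \rank V.
  rewrite -BV; apply/esym/eqP; apply/row_freeP; exists B^T; exact: BB.
rewrite /M {BAE MM M}; move: B BB BV; rewrite pE => B BB BV; set M := B *m A *m B^T.
pose W := row_base V; pose T := W *m B^T.
have WE : W = T *m B.
  have /submxP[D WD] : (W <= B)%MS by rewrite BV eq_row_base.
  by rewrite /T WD -[D *m B *m _]mulmxA BB mulmx1.
have uT : T \in unitmx.
  rewrite -row_free_unit; apply/row_freeP; exists (B *m pinvmx W).
  by rewrite mulmxA -WE mulmxVp // row_base_free.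
have TM : restrictmx V A *m T = T *m M.
  have WAE : W *m A *m pinvmx W *m W = W *m A.
    by rewrite mulmxKpV // stablemx_row_base.
  rewrite /conjmx -/W /T mulmxA WAE /M !mulmxA -[W *m B^T *m B](_ : W = _) //.
have /(congr1 determinant) := TM; rewrite !det_mulmx mulrC => /mulfI-> //.
by rewrite -unitfE -unitmxE.
Qed.

End Frames.

Section HalfTurns.
Variables (n : nat) (R : realType).
Hypothesis n_odd : odd n.
Local Notation Cl := (clifford n R).
Implicit Types (x y z : Cl) (u v w : 'rV[R]_n).

(** The rotation that fixes u and is -1 on its orthogonal complement. For odd n
    it is the reflection of vector u multiplied by -1, and the central volume
    element turns the odd element u into an even one. *)
Definition half_turn u : Cl := cl_vec u * cl_vol n R.

Lemma spin_mx_of_conj x (M : 'M[R]_n) : is_spin x ->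
  (forall v, x * cl_vec v * cl_rev x = cl_vec (v *m M)) -> spin_mx x = M^T.
Proof.
move=> xS xM; apply: trmx_inj; rewrite trmxK; apply/row_matrixP=> i.
by rewrite !rowE; apply: cl_vec_inj; rewrite -xM spin_mxE.
Qed.

Lemma half_turn_even u : cl_even (half_turn u).
Proof.
rewrite /half_turn /cl_vec mulr_suml; apply/forallP=> I; apply/implyP.
apply: contraNN => oI; rewrite cl_sumE big1 // => i _.
rewrite -scalerAl cl_basisM !cl_scaleE cl_basisE.
case: eqP => [E|]; last by rewrite !mulr0.
have := odd_card_symd [set i] [set: 'I_n].
by rewrite -E oI cards1 cardsT card_ord n_odd.
Qed.

Lemma half_turn_conj u v : u *m u^T = 1%:M ->
  half_turn u * cl_vec v * cl_rev (half_turn u) = cl_vec (v *m - refl u).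
Proof.
move=> uu; rewrite cl_revM cl_rev_vec /half_turn -[cl_vec u * _ * _]mulrA.
rewrite cl_vol_central // !mulrA -[_ * cl_vol n R * _]mulrA cl_basis_rev mulr1.
by rewrite cl_vec_refl // mulmxN linearN.
Qed.

Lemma is_spin_half_turn u : u *m u^T = 1%:M -> is_spin (half_turn u).
Proof.
move=> uu; have vv : half_turn u * cl_rev (half_turn u) = 1.
  rewrite cl_revM cl_rev_vec /half_turn mulrA -[_ * cl_vol n R * _]mulrA.
  by rewrite cl_basis_rev mulr1 cl_vec_unit.
apply/is_spinP; split; [exact: half_turn_even|by []| |].
  rewrite cl_revM cl_rev_vec /half_turn -mulrA [cl_vec u * (_ * _)]mulrA.
  rewrite cl_vec_unit // mul1r.
  rewrite cl_rev_basis -scalerAl scalerAr -cl_rev_basis; exact: cl_basis_rev.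
by move=> v; eexists; apply: half_turn_conj.
Qed.

Lemma spin_mx_half_turn u : u *m u^T = 1%:M -> spin_mx (half_turn u) = - refl u.
Proof.
move=> uu; rewrite (@spin_mx_of_conj _ (- refl u)) ?is_spin_half_turn //.
  by rewrite linearN /= tr_refl.
by move=> v; apply: half_turn_conj.
Qed.

(** Every orthogonal matrix is a product of reflections, and each of them is the
    opposite of a half-turn. *)
Lemma spin_mx_surjective (A : 'M[R]_n) : A *m A^T = 1%:M ->
  exists2 x, is_spin x & spin_mx x = A \/ spin_mx x = - A.
Proof.
move: A; apply: orthogonal_ind => [|u A uu [x xS xA]].
  by exists 1; [apply: is_spin1|left; apply: spin_mx1].
exists (x * half_turn u); first by rewrite is_spinM ?is_spin_half_turn.
rewrite spin_mxM ?is_spin_half_turn // spin_mx_half_turn // mulmxN.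
by case: xA => ->; [right|left; rewrite mulNmx opprK].
Qed.

(** An element of Spin(n) with the same conjugation properties as the volume
    element, of which it is a multiple by a central element. *)
Definition frame_turn p (B : 'M[R]_(p, n)) : Cl := \prod_(i < p) half_turn (row i B).

Lemma frame_turnE p (B : 'M[R]_(p, n)) : frame_turn B = frame_prod B * cl_vol n R ^+ p.
Proof.
rewrite /frame_turn /frame_prod -[p in _ ^+ p](card_ord p) -sum1_card.
elim/big_rec3: _ => [|i m y x _ ->]; first by rewrite mulr1.
by rewrite /half_turn exprS -!mulrA; congr (_ * _); rewrite mulrA cl_vol_central // mulrA.
Qed.

Lemma is_spin_frame_turn p (B : 'M[R]_(p, n)) :
  B *m B^T = 1%:M -> is_spin (frame_turn B).
Proof.
move=> BB; rewrite /frame_turn; elim/big_rec: _ => [|i x _ xS]; first exact: is_spin1.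
by rewrite is_spinM ?is_spin_half_turn // (row_frame_unit BB).
Qed.

Lemma cl_volX_central k x : cl_vol n R ^+ k * x = x * cl_vol n R ^+ k.
Proof.
elim: k => [|k IHk]; first by rewrite mul1r mulr1.
by rewrite exprS -mulrA IHk mulrA cl_vol_central // mulrA.
Qed.

Lemma spin_conj_stable_frame_turn x (V : 'M[R]_n) p (B : 'M[R]_(p, n)) :
    is_spin x -> stablemx V (spin_mx x)^T -> B *m B^T = 1%:M -> (B :=: V)%MS ->
  x * frame_turn B * cl_rev x =
  \det (restrictmx V (spin_mx x)^T) *: frame_turn B.
Proof.
move=> xS Vx BB BV; rewrite frame_turnE mulrA -mulrA cl_volX_central mulrA.
by rewrite (spin_conj_stable_frame xS Vx BB BV) -scalerAl.
Qed.

End HalfTurns.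

(** * The spin representation *)

Section SpinRepUnitary.
Variables (R : realType) (n : nat).
Local Notation C := (complex R).
Local Notation Cl := (clifford n R).
Implicit Types x y : Cl.

Lemma spin_rep_linear a x y :
  spin_rep (a *: x + y) = (a%:C)%C *: spin_rep x + spin_rep y.
Proof.
rewrite /spin_rep scaler_sumr -big_split; apply: eq_bigr => I _ /=.
by rewrite cl_addE cl_scaleE rmorphD rmorphM scalerDl scalerA.
Qed.

Lemma spin_rep0 : spin_rep (0 : Cl) = 0.
Proof. by rewrite /spin_rep big1 // => I _; rewrite ffunE scale0r. Qed.

Lemma spin_repZ a x : spin_rep (a *: x) = (a%:C)%C *: spin_rep x.
Proof. by rewrite -[a *: x]addr0 spin_rep_linear spin_rep0 addr0. Qed.

Lemma spin_rep_basis1 i : spin_rep (cl_basis R [set i]) = spin_gamma R n./2 i.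
Proof.
rewrite /spin_rep (bigD1 [set i]) //= [X in _ + X]big1 => [|I /negPf Ii].
  rewrite addr0 cl_basisE eqxx scale1r (eq_bigl (pred1 i)) ?big_pred1_eq // => j.
  by rewrite inE.
by rewrite cl_basisE Ii scale0r.
Qed.

Lemma spin_gamma_hermitian k i : adjoint Num.conj (spin_gamma R k i) = spin_gamma R k i.
Proof.
have conj_i : Num.conj ('i%C : C) = - 'i%C by rewrite complexiE conjCi.
have conj_Ni : Num.conj (- 'i%C : C) = 'i%C by rewrite rmorphN /= conj_i opprK.
have conj_N1 : Num.conj (- 1 : C) = -1 by rewrite rmorphN rmorph1.
elim: k i => [|k IHk] i /=; first exact: adj1.
rewrite /adjoint; case: ifP => _; last case: ifP => _;
  rewrite map_block_mx tr_block_mx !map_mx0 !trmx0.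
- by have := IHk i; rewrite /adjoint => ->.
- rewrite !map_scalar_mx !tr_scalar_mx.
  by congr (block_mx _ _%:M _%:M _); [exact: conj_i|exact: conj_Ni].
- rewrite !map_scalar_mx !tr_scalar_mx.
  by congr (block_mx _%:M _ _ _%:M); [exact: rmorph1|exact: conj_N1].
Qed.

(** The gamma matrices are hermitian, and both sides reverse products. *)
Lemma spin_rep_rev x : spin_rep (cl_rev x) = adjoint Num.conj (spin_rep x).
Proof.
elim/(@cl_basis_induction n R): x => [|i x IHx|a x y IHx IHy].
- by rewrite cl_rev1 spin_rep1 adj1.
- rewrite cl_revM !spin_repM adjM IHx; congr (_ *m _).
  rewrite cl_rev_basis cards1 scale1r spin_rep_basis1; exact/esym/spin_gamma_hermitian.
have -> : cl_rev (a *: x + y) = a *: cl_rev x + cl_rev y.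
  by apply/ffunP=> I; rewrite cl_revE !cl_addE !cl_scaleE !cl_revE mulrDr mulrCA.
rewrite !spin_rep_linear adjD adjZ IHx IHy; congr (_ *: _ + _).
by apply/esym/CrealP/complex_realP; eexists.
Qed.

(** If I is nonempty of even cardinal and i belongs to I, then e_i anticommutes
    with e_I, so that e_I acts with trace 0. *)
Lemma tr_spin_rep x : cl_even x ->
  \tr (spin_rep x) = (spin_dim n./2)%:R * ((x set0)%:C)%C.
Proof.
move=> /forallP xE; rewrite {1}(cl_expand x).
have -> : spin_rep (\sum_I x I *: cl_basis R I) =
    \sum_I ((x I)%:C)%C *: spin_rep (cl_basis R I).
  by apply: (big_rec2 (fun y z => spin_rep y = z)) => [|I y z _ <-];
    rewrite ?spin_rep0 ?spin_rep_linear.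
rewrite raddf_sum (bigD1 set0) //= big1 ?addr0 => [|I I0].
  by rewrite mxtraceZ cl_basis0 spin_rep1 mxtrace1 mulrC.
rewrite mxtraceZ; have [->|xI] := eqVneq (x I) 0; first by rewrite mul0r.
have /implyP/(_ xI) eI := xE I; have /set0Pn[i iI] := I0.
pose e := cl_basis R [set i] : Cl.
have ee : e * e = 1 by rewrite cl_basisM symdd /cl_sign inversions1 ltnn scale1r.
have eC : e * cl_basis R I = - (cl_basis R I * e).
  rewrite !cl_basisM cl_signC; have -> : [set i] :&: I = [set i].
    by apply/setIidPl; rewrite sub1set.
  by rewrite cards1 mul1n -signr_odd oddD (negPf eI) expr1 mulN1r scaleNr symdC.
have : \tr (spin_rep (cl_basis R I)) = - \tr (spin_rep (cl_basis R I)).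
  rewrite -[in LHS](mulr1 (cl_basis R I)) -ee mulrA spin_repM mxtrace_mulC -spin_repM.
  rewrite mulrA eC mulNr -mulrA ee mulr1 -scaleN1r spin_repZ mxtraceZ.
  by rewrite rmorphN rmorph1 mulN1r.
by move/eqP; rewrite -addr_eq0 -mulr2n mulrn_eq0 /= => /eqP ->; rewrite mulr0.
Qed.

End SpinRepUnitary.

(** * Unacceptable morphisms *)

Section Characterization.
Variables (R : realType) (n : nat) (Gamma : groupType).
Hypothesis n_odd : odd n.
Variable r : {multiplicative Gamma -> spin n R}.
Let S gamma := spin_rep (r gamma).
Let E gamma := spin_mx (r gamma).

Lemma spin_val_conj (x g : spin n R) :
  spin_val (x ^ g)%g = cl_rev (spin_val g) * (spin_val x * spin_val g).
Proof. by []. Qed.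

Lemma spin_valM (x y : spin n R) : spin_val (x * y)%g = spin_val x * spin_val y.
Proof. by []. Qed.

Lemma E_mul g h : E (g * h)%g = E g *m E h.
Proof. by rewrite /E gmulfM spin_mxM ?spin_valP. Qed.

Lemma E_orthogonal g : E g *m (E g)^T = 1%:M.
Proof. by rewrite spin_mx_orthogonalC ?spin_valP. Qed.

Lemma S_unitary : unitary_rep Num.conj S.
Proof.
split=> [g h|g]; first by rewrite /S gmulfM spin_repM.
have [_ xx _ _] := is_spinP _ (spin_valP (r g)).
by rewrite -spin_rep_rev -spin_repM xx spin_rep1.
Qed.

Lemma twist_unitary (eta : Gamma -> int) :
  (forall g h, eta (g * h)%g = eta g * eta h) ->
  (forall g, eta g = 1 \/ eta g = -1) -> unitary_rep Num.conj (rep_twist eta S).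
Proof.
move=> etaM eta1; have [SM SU] := S_unitary; split=> [g h|g].
  by rewrite /rep_twist etaM SM rmorphM /= -scalemxAl -scalemxAr scalerA.
rewrite adjZ -scalemxAl -scalemxAr SU scalerA.
by case: (eta1 g) => ->; rewrite ?rmorphN ?rmorph1 ?mulrNN mulr1 scale1r.
Qed.

(** Conjugating by the half-turns along an orthonormal basis of V multiplies
    each r gamma by the determinant of gamma on V. *)
Lemma submodule_det_conj (V : 'M[R]_n) (eta : Gamma -> int) :
    (forall g, eta g = 1 \/ eta g = -1) -> submodule E V ->
    (forall g, submodule_det E V g = (eta g)%:~R) ->
  exists h : spin n R, forall g, spin_val (r g ^ h)%g = (eta g)%:~R *: spin_val (r g).
Proof.
move=> eta1 VE Vdet; have [p [B [BB BV]]] := orthonormal_basis V.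
have hS := is_spin_frame_turn n_odd BB; exists (Spin hS) => g.
rewrite spin_val_conj; apply: spin_conj_sign => //; first exact: spin_valP.
rewrite -Vdet; apply: spin_conj_stable_frame_turn => //; [exact: spin_valP|exact: VE].
Qed.

Lemma unacceptable_character : unacceptable r ->
  exists eta : Gamma -> int,
    [/\ order2_character eta, rep_iso S (rep_twist eta S) &
      ~ exists V : 'M[R]_n, submodule E V /\
          forall gamma, submodule_det E V gamma = (eta gamma)%:~R].
Proof.
move=> [r' [conj_r' nconj_r']].
pose E' gamma := spin_mx (r' gamma).
have trE g : \tr (E g) = \tr (E' g).
  have [h rh] := conj_r' g; rewrite /E' rh spin_val_conj.
  have [_ hh _ _] := is_spinP _ (spin_valP h).
  rewrite !spin_mxM ?is_spin_rev ?is_spinM ?spin_valP // mxtrace_mulC -mulmxA.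
  by rewrite -spin_mxM ?is_spin_rev ?spin_valP // hh spin_mx1 mulmx1.
have [U UU UE] : exists2 U, U *m U^T = 1%:M & forall g, E g *m U = U *m E' g.
  apply: orthogonal_equivalence trE; [exact: E_mul|exact: E_orthogonal| |] => g.
    by move=> h; rewrite /E' gmulfM spin_mxM ?spin_valP.
  by rewrite spin_mx_orthogonalC ?spin_valP.
have [u0 u0S u0U] := spin_mx_surjective n_odd UU; pose u := Spin u0S.
(* r' and the conjugate of r by u have the same image in SO(n). *)
have r'E g : spin_val (r' g) = spin_val (r g ^ u)%g \/
    spin_val (r' g) = - spin_val (r g ^ u)%g.
  apply: spin_mx_eq; try exact: spin_valP.
  rewrite spin_val_conj !spin_mxM ?is_spinM ?is_spin_rev ?spin_valP // spin_mx_rev //.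
  have U'U : U^T *m U = 1%:M by rewrite (mulmx1C UU).
  rewrite -/(E g) -/(E' g).
  by case: u0U => ->; rewrite ?linearN /= ?mulmxN ?mulNmx ?opprK UE mulmxA U'U mul1mx.
pose eta g : int := if spin_val (r' g) == spin_val (r g ^ u)%g then 1 else -1.
have eta1 g : eta g = 1 \/ eta g = -1 by rewrite /eta; case: ifP; [left|right].
have etaE g : spin_val (r' g) = (eta g)%:~R *: spin_val (r g ^ u)%g.
  rewrite /eta; case: eqP => [->|ne]; first by rewrite scale1r.
  by case: (r'E g) => // ->; rewrite scaleN1r.
have etaM g h : eta (g * h)%g = eta g * eta h.
  apply/eqP; rewrite -(eqr_int R); apply/eqP.
  apply: (spin_sign_unique (spin_valP (r (g * h) ^ u)%g)).
  rewrite -etaE !gmulfM conjMg !spin_valM !etaE rmorphM /=.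
  by rewrite -scalerAl -scalerAr scalerA.
exists eta; split; first split=> //.
- apply: contrapT => noeta; apply: nconj_r'; exists u => g; apply: val_inj.
  rewrite /= etaE; have [->|e1] := eta1 g; first by rewrite scale1r.
  by case: noeta; exists g; rewrite e1.
- have trS g : \tr (rep_twist eta S g) = \tr (S g).
    rewrite /rep_twist mxtraceZ tr_spin_rep; last by have [] := is_spinP _ (spin_valP (r g)).
    rewrite mulrCA; congr (_ * _).
    have [h rh] := conj_r' g; have := etaE g; rewrite rh !spin_val_conj.
    have c0 (x : spin n R) : (cl_rev (spin_val x) * (spin_val (r g) * spin_val x)) set0 =
        spin_val (r g) set0.
      rewrite cl_coef0_mulC -mulrA; have [_ -> _ _] := is_spinP _ (spin_valP x).
      by rewrite mulr1.
    move/ffunP/(_ set0); rewrite cl_scaleE !c0 => {2}->.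
    by rewrite rmorphM /= rmorph_int.
  have [P uP PI] := unitary_equivalenceC (twist_unitary etaM eta1) S_unitary trS.
  by exists P => // g; rewrite PI.
move=> [V [VE Vdet]]; have [h rh] := submodule_det_conj eta1 VE Vdet.
apply: nconj_r'; exists (h * u)%g => g; apply: val_inj.
rewrite -[LHS]/(spin_val (r' g)) -[RHS]/(spin_val (r g ^ (h * u))%g).
by rewrite conjgM etaE [RHS]spin_val_conj rh spin_val_conj -scalerAl -scalerAr.
Qed.

Section Twist.
Variable eta : Gamma -> int.
Hypothesis etaM : forall g h, eta (g * h)%g = eta g * eta h.
Hypothesis eta1 : forall g, eta g = 1 \/ eta g = -1.

Definition twisted_spin gamma := Spin (is_spin_sign (eta1 gamma) (spin_valP (r gamma))).

Lemma twisted_spinM : {morph twisted_spin : g h / (g * h)%g}.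
Proof.
move=> g h; apply: val_inj; rewrite /= gmulfM etaM rmorphM /=.
by rewrite -scalerAl -scalerAr scalerA.
Qed.

(** Trace 0 forces the eigenvalue -1, and the half-turn fixing an eigenvector u
    conjugates r gamma to its opposite. *)
Lemma twisted_spin_conj gamma : \tr (S gamma) = 0 \/ eta gamma = 1 ->
  exists g, twisted_spin gamma = (r gamma ^ g)%g.
Proof.
case: (eta1 gamma) => e1 trS.
  by exists 1%g; apply: val_inj; rewrite conjg1 /= e1 scale1r.
case: trS => [trS|]; last by rewrite e1.
set x := r gamma; have xS := spin_valP x; have [xE xx x'x _] := is_spinP _ xS.
have x0 : spin_val x set0 = 0.
  move/eqP: trS; rewrite tr_spin_rep // mulf_eq0 pnatr_eq0 spin_dimE expn_eq0 /=.
  by rewrite fmorph_eq0 => /eqP.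
pose A := (spin_mx x)^T.
have : 1%:M + A \notin unitmx.
  apply: contra_eqN x0 => uA; apply: (cl_scalar_part_neq0 _ _ uA).
    by apply/eqP=> x00; move: xx; rewrite x00 mul0r => /esym/eqP; rewrite oner_eq0.
  by move=> v; rewrite cl_hat_even // /A -spin_mxE // -[RHS]mulrA x'x mulr1.
rewrite -row_free_unit -kermx_eq0 => /rowV0Pn[d dker d0].
have [u uu [c c0 dE]] := unit_multiple d0.
have uA : u *m A = - u.
  apply/eqP; rewrite -addr_eq0 addrC -[X in X + _]mulmx1 -mulmxDr.
  by move/sub_kermxP: dker; rewrite dE -scalemxAl => /eqP; rewrite scaler_eq0 (negPf c0).
have hS := is_spin_half_turn n_odd uu; exists (Spin hS); apply: val_inj.
rewrite -[RHS]/(spin_val (x ^ Spin hS)%g) spin_val_conj /= -/x.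
apply/esym/spin_conj_sign => //.
rewrite e1 /half_turn mulrA -mulrA cl_vol_central // mulrA spin_mxE // -/A uA.
by rewrite linearN mulNr scaleN1r.
Qed.

(** V is the eigenspace of g for the eigenvalue -1 and y its volume element. The
    scalar coefficient of h = y g is nonzero, it is invariant under conjugation
    by r gamma, and that conjugation multiplies h by det (gamma | V) times
    eta gamma. *)
Lemma twisted_spin_submodule (g : spin n R) :
    (forall gamma, twisted_spin gamma = (r gamma ^ g)%g) ->
  exists V : 'M[R]_n, submodule E V /\
    forall gamma, submodule_det E V gamma = (eta gamma)%:~R.
Proof.
move=> gE; set z := spin_val g; have zS : is_spin z := spin_valP g.
have [zE zz z'z _] := is_spinP _ zS.
pose A := (spin_mx z)^T; have AA : A *m A^T = 1%:M by rewrite trmxK spin_mx_orthogonal.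
have rz gamma : spin_val (r gamma) * z = (eta gamma)%:~R *: (z * spin_val (r gamma)).
  have := congr1 (@spin_val n R) (gE gamma); rewrite spin_val_conj /= -/z => E1.
  by rewrite scalerAr E1 [RHS]mulrA zz mul1r.
have EA gamma : (E gamma)^T *m A = A *m (E gamma)^T.
  have rS := spin_valP (r gamma).
  rewrite /A -!trmx_mul /E -!spin_mxM //.
  by rewrite rz spin_mx_sign.
pose V := kermx (A + 1%:M); have VA : V *m A = - V.
  by apply/eqP; rewrite -addr_eq0 -[X in _ + X]mulmx1 -mulmxDr mulmx_ker.
have VE : submodule E V.
  move=> gamma; apply/sub_kermxP.
  by rewrite mulmxDr mulmx1 -mulmxA EA mulmxA VA mulNmx addNr.
exists V; split=> // gamma.
have [p [B [BB BV]]] := orthonormal_basis V.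
pose y := frame_prod B; pose h := y * z; pose Q := B^T *m B.
have BA : B *m A = - B.
  have /submxP[D ->] : (B <= V)%MS by rewrite BV.
  by rewrite -mulmxA VA mulmxN.
have QA : Q *m A = - Q by rewrite -mulmxA BA mulmxN.
have AQ : A *m Q = - Q.
  have BA' : B *m A^T = - B.
    by rewrite -[in LHS](opprK B) -BA mulNmx -mulmxA AA mulmx1.
  have := congr1 trmx BA'; rewrite trmx_mul trmxK linearN /= => AB.
  by rewrite mulmxA AB mulNmx.
have QQ : Q *m Q = Q by rewrite -mulmxA [B *m _]mulmxA BB mul1mx.
have h0 : h set0 != 0.
  apply: (@cl_scalar_part_neq0 _ _ _ (A *m (1%:M - 2 *: Q))).
  - apply/eqP=> hz0; move: zz.
    have -> : z = 0 by rewrite -[z]mul1r -(frame_prod_rev BB) -mulrA -/y -/h hz0 mulr0.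
    by rewrite mul0r => /esym/eqP; rewrite oner_eq0.
  - move=> v; rewrite /h cl_hatM (cl_hat_even zE) -mulrA.
    have -> : z * cl_vec v = cl_vec (v *m A) * z.
      by rewrite /A -spin_mxE // -[RHS]mulrA z'z mulr1.
    by rewrite mulrA frame_mul_vec // -/Q !mulmxA -mulrA.
  (* Composing A with the reversal of V removes the eigenvalue -1. *)
  have -> : A *m (1%:M - 2 *: Q) = A + 2 *: Q.
    by rewrite mulmxBr mulmx1 -scalemxAr AQ scalerN opprK.
  rewrite -row_free_unit -kermx_eq0; apply/negPn/negP=> /rowV0Pn[v /sub_kermxP].
  rewrite !mulmxDr mulmx1 -scalemxAr => v0; case/negP; apply/eqP.
  have vQ : v *m Q = 0.
    have := congr1 (mulmx^~ Q) v0.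
    rewrite mul0mx !mulmxDl -mulmxA AQ mulmxN -scalemxAl -mulmxA QQ addrA subrr add0r.
    by move/eqP; rewrite scaler_eq0 pnatr_eq0 => /eqP.
  have vA : v *m A = - v.
    by move: v0; rewrite vQ scaler0 addr0 addrC => /eqP; rewrite addr_eq0 => /eqP.
  have /submxP[D vD] : (v <= B)%MS.
    by rewrite BV; apply/sub_kermxP; rewrite mulmxDr mulmx1 vA addNr.
  by rewrite -vQ vD /Q mulmxA -[D *m B *m _]mulmxA BB mulmx1.
have rS := spin_valP (r gamma); set x := spin_val (r gamma) in rS *.
have [_ xx x'x _] := is_spinP _ rS.
have ee : (eta gamma)%:~R * (eta gamma)%:~R = 1 :> R.
  by case: (eta1 gamma) => ->; rewrite ?mulr1 ?mulrNN ?mulr1.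
have xy := spin_conj_stable_frame rS (VE gamma) BB BV.
rewrite -/y -[\det _]/(submodule_det E V gamma) in xy; set d := submodule_det _ _ _ in xy *.
have xz : x * z * cl_rev x = (eta gamma)%:~R *: z.
  by rewrite rz -scalerAl -mulrA xx mulr1.
have xh : x * h * cl_rev x = (d * (eta gamma)%:~R) *: h.
  have -> : x * h * cl_rev x = (x * y * cl_rev x) * (x * z * cl_rev x).
    by rewrite /h !mulrA -[_ * cl_rev x * x]mulrA x'x mulr1.
  by rewrite xy xz -scalerAl -scalerAr scalerA.
have := spin_conj_coef0 h rS; rewrite xh cl_scaleE -[RHS]mul1r => /(mulIf h0) de.
by move/(congr1 ( *%R^~ (eta gamma)%:~R)): de; rewrite -mulrA ee mulr1 mul1r.
Qed.

End Twist.

Lemma character_unacceptable (eta : Gamma -> int) :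
    order2_character eta -> rep_iso S (rep_twist eta S) ->
    ~ (exists V : 'M[R]_n, submodule E V /\
        forall gamma, submodule_det E V gamma = (eta gamma)%:~R) ->
  unacceptable r.
Proof.
move=> [etaM eta1 _] [P uP PI] noV.
pose r' : {multiplicative Gamma -> spin n R} :=
  HB.pack (twisted_spin eta1) (isMultiplicative.Build _ _ _ (twisted_spinM etaM eta1)).
exists r'; split=> [gamma|[g gE]].
  apply: twisted_spin_conj; have [->|e1] := eta1 gamma; [by right|left].
  have : \tr (S gamma) = - \tr (S gamma).
    rewrite -{1}[S gamma]mul1mx -(mulVmx uP) -mulmxA PI /rep_twist e1.
    by rewrite rmorphN rmorph1 scaleN1r mulNmx mulmxN raddfN /= mxtrace_mulC mulmxK.
  by move/eqP; rewrite -addr_eq0 -mulr2n mulrn_eq0 /= => /eqP.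
by apply: noV; apply: twisted_spin_submodule gE.
Qed.

End Characterization.

Theorem theorem1p2 (R : realType) (n : nat) (n_ge1 : (1 <= n)%N)
    (n_odd : odd n) (Gamma : groupType)
    (r : {multiplicative Gamma -> spin n R}) :
  let S := fun gamma : Gamma => spin_rep (r gamma) in
  let E := fun gamma : Gamma => spin_mx (r gamma) in
  unacceptable r <->
  exists eta : Gamma -> int,
    [/\ order2_character eta,
        rep_iso S (rep_twist eta S) &
        ~ exists V : 'M[R]_n,
            submodule E V /\
            forall gamma, submodule_det E V gamma = (eta gamma)%:~R].
Proof.
move=> S E; split; first exact: unacceptable_character.
by case=> eta [etaO SE noV]; apply: character_unacceptable SE noV.
Qed.
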